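(* Let $\rho\le\theta<1$ when $L\ge2$, or $\rho<\theta<1$ when $L=1$. Then under the invariant laws (i.e. when, for each $N\ge L$, $R^N_0$ has the invariant law of $R^N$), $$\limsup_{N\ge L}\mathbb{E}\left(\|Z^N_0\|_{L_2(g_\theta)}^2\right)<\infty,\qquad\text{where } Z^N_0=N^{1/2}(R^N_0-\tilde u).$$
   Context: Network: $\alpha,\beta>0$ with $\rho=\alpha/\beta<1$, $L\ge1$ an integer, $N\ge L$. There are $N$ single-server infinite-buffer queues, each server working at rate $\beta$ (exponential services). Customers arrive according to a Poisson process of rate $N\alpha$; each customer is allocated $L$ distinct queues uniformly at random and joins the shortest one, ties being resolved uniformly. Inter-arrival times, allocations and services are independent. $X^N_i(t)$ is the length of queue $i$ at time $t$, and $R^N_t(k)=\frac1N\sum_{i=1}^N\mathbf{1}_{\{X^N_i(t)\ge k\}}$, $k\in\mathbb{N}=\{0,1,\dots\}$. $R^N$ is a Markov process on $\mathcal{V}^N=\mathcal{V}\cap\frac1N\mathbb{N}^{\mathbb{N}}$, where $\mathcal{V}$ is the set of sequences $(v(k))_{k\in\mathbb{N}}$ with $v(0)=1$, $v(k)\ge v(k+1)$, $\lim_k v(k)=0$. It is known to be ergodic, with a unique invariant law, because $\alpha<\beta$. $\tilde u(k)=\rho^{1+L+\cdots+L^{k-1}}=\rho^{(L^k-1)/(L-1)}$ (read as $\rho^k$ if $L=1$). $g_\theta=(\theta^k)_{k\ge1}$ and $\|x\|_{L_2(g_\theta)}^2=\sum_{k\ge1}x(k)^2\theta^{-k}$ for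 real sequences $x$ with $x(0)=0$. *)

(* Defs.v *)
From HB Require Import structures.
From mathcomp Require Import all_boot all_order all_algebra.
From mathcomp Require Import all_classical all_reals all_analysis.

Set Implicit Arguments.
Unset Strict Implicit.
Unset Printing Implicit Defensive.
Import Order.TTheory GRing.Theory Num.Theory.
Import numFieldNormedType.Exports.

Local Open Scope classical_set_scope.
Local Open Scope ring_scope.

Section Network.
Context {R : realType}.

Definition config (N : nat) := {ffun 'I_N -> nat}.

Definition add_customer N (x : config N) (i : 'I_N) : config N :=
  [ffun j => if j == i then (x j).+1 else x j].

Definition remove_customer N (x : config N) (i : 'I_N) : config N :=
  [ffun j => if j == i then (x j).-1 else x j].

Definition shortest N (x : config N) (A : {set 'I_N}) : {set 'I_N} :=
  [set i in A | [forall j in A, (x i <= x j)%N]]%SET.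

(* Infinitesimal generator of the queue length process.  Arrivals: at rate
   N alpha, a uniform L-subset A of the queues is drawn (there are 'C(N, L)
   of them), and the customer joins a uniform element of shortest x A.
   Services: each non-empty queue loses a customer at rate beta. *)
Definition generator (alpha beta : R) (L N : nat)
    (f : config N -> R) (x : config N) : R :=
  (\sum_(A : {set 'I_N} | #|A| == L)
     N%:R * alpha / 'C(N, L)%:R *
     \sum_(i in shortest x A)
       (#|shortest x A|%:R)^-1 * (f (add_customer x i) - f x))
  + \sum_(i < N | (0 < x i)%N) beta * (f (remove_customer x i) - f x).

(* The transition semigroup exp (t Q) f = \sum_n t^n / n! Q^n f.  All jump
   rates are bounded by N (alpha + beta), so Q is a bounded operator on bounded
   functions and the series converges absolutely for every bounded f. *)
Definition semigroup (alpha beta : R) (L N : nat) (t : R)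
    (f : config N -> R) (x : config N) : R :=
  limn (series (fun n : nat =>
    t ^+ n / n`!%:R * iter n (generator alpha beta L (N := N)) f x)).

Section Process.
Context {d : measure_display} {Omega : measurableType d}.

(* Natural filtration of X at time s. *)
Definition history N (X : R -> Omega -> config N) (s : R) :
    set (set Omega) :=
  <<s [set A | exists u x, [/\ 0 <= u, u <= s &
                               A = [set w | X u w = x]]] >>.

(* X is a queue length process (X t w i is X^N_i(t)): a Markov process, with
   arbitrary initial law, with the above semigroup, i.e. for bounded f,
   E (f (X_(s+t)) | X_u, u <= s) = (P_t f) (X_s).  The state space is countable
   and carries the discrete sigma-algebra. *)
Definition queue_length_process (alpha beta : R) (L N : nat)
    (P : probability Omega R) (X : R -> Omega -> config N) : Prop :=
  (forall t x, 0 <= t -> measurable [set w | X t w = x]) /\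
  (forall s t, 0 <= s -> 0 <= t ->
   forall A, history X s A ->
   forall f : config N -> R, (exists M, forall x, `|f x| <= M) ->
   (\int[P]_(w in A) (f (X (s + t) w))%:E =
    \int[P]_(w in A) (semigroup alpha beta L t f (X s w))%:E)%E).

(* k |-> R^N_t(k), the fraction of queues of length at least k at time t. *)
Definition tail_process N (X : R -> Omega -> config N) (t : R)
    (w : Omega) : nat -> R :=
  fun k => #|[set i : 'I_N | (k <= X t w i)%N]%SET|%:R / N%:R.

(* The law of R^N_0 is invariant: R^N_t has the law of R^N_0 for all t >= 0.
   R^N_t takes countably many values, so every set of sequences has a
   measurable preimage. *)
Definition starts_from_invariant_law N (P : probability Omega R)
    (X : R -> Omega -> config N) : Prop :=
  forall t, 0 <= t -> forall B : set (nat -> R),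
    P (tail_process X t @^-1` B) = P (tail_process X 0 @^-1` B).

End Process.

Definition u_tilde (rho : R) (L : nat) : nat -> R :=
  fun k => rho ^+ (\sum_(j < k) L ^ j)%N.

(* Squared norm of L_2(g_theta), +oo when the series diverges. *)
Definition sqnorm_L2g (theta : R) (x : nat -> R) : \bar R :=
  (\sum_(1 <= k <oo) (x k ^+ 2 * theta ^- k)%:E)%E.

Definition Z0 d (Omega : measurableType d) (rho : R) (L N : nat)
    (X : R -> Omega -> config N) (w : Omega) : nat -> R :=
  fun k => Num.sqrt N%:R * (tail_process X 0 w k - u_tilde rho L k).

End Network.

(* Main.v *)
(* Write v for the tail process, u for u_tilde and c for a truncation of u.  The
   mean-field drift is not contracting in L_2(g_theta), but v |-> v(k)^L is
   increasing, so v - u obeys a linear system exchanging mass between neighbouring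
   levels with nonnegative rates.  Such a system contracts a weighted l^1 norm
   with weights W_k of order theta^(-k/2), because
   (v^L - u^L) / (v - u) <= 1 + (L - 1) u(k) and u is summable.  The square of that
   norm, with the absolute values smoothed at the scale of the fluctuations, is the
   Lyapunov function Phi^2; as one jump moves a single level by 1/N, the noise
   enters only through sum_k W_k^2 E v(k-1), of order theta^(-k) in place of the
   square of a sum.  Stationarity, E (generator Phi^2) = 0, then bounds E Phi^2 by
   C / N.  Phi only involves the levels up to n, so that it is bounded; the flux
   lost at level n is a term of a convergent series, and vanishes as n grows. *)

Require Import Defs.
From HB Require Import structures.
From mathcomp Require Import all_boot all_order all_algebra.
From mathcomp Require Import all_classical all_reals all_analysis.
From mathcomp Require Import measurable_realfun ring lra.

Set Implicit Arguments.
Unset Strict Implicit.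
Unset Printing Implicit Defensive.
Import Order.TTheory GRing.Theory Num.Theory.
Import numFieldNormedType.Exports.

Local Open Scope classical_set_scope.
Local Open Scope ring_scope.

(** * Transition rates of the tail process *)

Section Combinatorics.
Context {R : realType}.
Implicit Types (N L k : nat).

(** Two rates carry the estimates: [r], the square root of 1/theta, at which the weights grow, and
    [s], chosen so that u(k) is at most of order s^(2k). As v(k) should fluctuate about u(k) by
    roughly the square root of u(k)/N, the smoothing has scale s^k/m with m = sqrt N. It costs sum_k
    W_k s^k/m, and its curvature turns the jumps into a drift of order sum_k W_k s^(-k) u(k-1)/m;
    both series are geometric of ratio r s < 1. The drift of Phi is thus at most -g Phi + O(1/m), up
    to the flux at level n, and squaring yields O(1/N). The l^1 norm is imposed by the contraction,
    but its square still dominates sum_k W_k^2 (v(k) - c(k))^2, which is comparable to the squared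
    norm of L_2(g_theta). Some errors are proportional to the deviation itself: part of the sampling
    error, of the curvature, and of the noise when L >= 2. They are absorbed into the contraction,
    which dictates the size of [a] and a lower bound on N; the limsup only sees large N. *)

Definition tail N (x : config N) k : R :=
  #|[set i : 'I_N | (k <= x i)%N]%SET|%:R / N%:R.

(* Probability that the L sampled queues all have length at least k, the
   finite-N counterpart of tail x k ^+ L. *)
Definition sample_tail L N (x : config N) k : R :=
  'C(#|[set i : 'I_N | (k <= x i)%N]%SET|, L)%:R / 'C(N, L)%:R.

(** All shortest queues of [A] have the same length, the minimum over [A], so the tie-breaking
    weights add up to one in front of a common indicator: the minimum is at least k exactly when
    every sampled queue is that long. *)
Lemma sum_shortest L N (x : config N) (A : {set 'I_N}) k : (0 < L)%N ->
  #|A| = L ->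
  \sum_(i in shortest x A) (#|shortest x A|%:R)^-1 * (k <= x i)%N%:R
  = (A \subset [set i : 'I_N | (k <= x i)%N]%SET)%:R :> R.
Proof.
move=> L0 cA.
have /card_gt0P [i0 i0A] : (0 < #|A|)%N by rewrite cA.
case: (arg_minnP (fun i => x i) i0A) => m mA mmin.
have mS : m \in shortest x A.
  by rewrite !inE; apply/andP; split=> //; apply/forallP => j; apply/implyP => /mmin.
have kE i : i \in shortest x A ->
    (k <= x i)%N = (A \subset [set i : 'I_N | (k <= x i)%N]%SET).
  rewrite !inE => /andP[iA /forallP ile]; apply/idP/fintype.subsetP => [ki j jA|H].
    by rewrite inE (leq_trans ki)//; have := ile j; rewrite jA.
  by have := H _ iA; rewrite inE.
rewrite (eq_bigr (fun=> (#|shortest x A|%:R)^-1 *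
    (A \subset [set i : 'I_N | (k <= x i)%N]%SET)%:R)); last first.
  by move=> i /kE ->.
rewrite sumr_const -mulrnAl -[_^-1 *+ _]mulr_natr mulVf ?mul1r//.
by rewrite pnatr_eq0 -lt0n; apply/card_gt0P; exists m.
Qed.

Lemma sum_arrivals L N (x : config N) (a : R) k : (0 < L)%N -> (L <= N)%N ->
  \sum_(A : {set 'I_N} | #|A| == L) N%:R * a / 'C(N, L)%:R *
     \sum_(i in shortest x A) (#|shortest x A|%:R)^-1 * (k <= x i)%N%:R
  = N%:R * (a * sample_tail L x k).
Proof.
move=> L0 LN.
under eq_bigr => A /eqP cA do rewrite (sum_shortest _ _ L0 cA).
rewrite -big_distrr/= /sample_tail; set B := [set i | _]%SET.
suff -> : \sum_(A : {set 'I_N} | #|A| == L) (A \subset B)%:R = 'C(#|B|, L)%:R :> R.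
  by ring.
rewrite -cards_draws -sum1_card natr_sum big_mkcond [RHS]big_mkcond/=.
by apply: eq_bigr => A _; rewrite inE andbC; case: (_ == _); case: (_ \subset _).
Qed.

Lemma sum_services N (x : config N) (b : R) k : (0 < N)%N -> (0 < k)%N ->
  \sum_(i < N | (0 < x i)%N) b * (k <= x i)%N%:R = N%:R * (b * tail x k).
Proof.
move=> N0 k0; rewrite /tail -sum1_card natr_sum big_mkcond/=.
rewrite mulrC -mulrA divfK ?pnatr_eq0 -?lt0n// mulr_sumr [RHS]big_mkcond/=.
apply: eq_bigr => i _; rewrite inE; case: (leqP k (x i)) => [ki|ki].
  by rewrite (leq_trans k0 ki).
by case: ifP => //; rewrite mulr0.
Qed.

Lemma eq_natB (m k : nat) : (m == k)%:R = (k <= m)%N%:R - (k < m)%N%:R :> R.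
Proof. by case: ltngtP => _; rewrite ?subrr ?subr0. Qed.

(** For functions whose increment depends only on the length of the queue that jumps, the generator
    is a sum over levels: [up k] is weighted by the rate at which some queue of length exactly k
    grows, [dn k] by the rate at which some queue of length k+1 shrinks. *)
Lemma generator_level_sum (a b : R) L N (f : config N -> R) (x : config N)
    n (up dn : nat -> R) : (0 < L)%N -> (L <= N)%N ->
  (forall i, f (add_customer x i) - f x = \sum_(k < n) up k * (x i == k)%:R) ->
  (forall i, (0 < x i)%N ->
     f (remove_customer x i) - f x = \sum_(k < n) dn k * (x i == k.+1)%:R) ->
  generator a b L f x = \sum_(k < n) N%:R *
    (up k * (a * (sample_tail L x k - sample_tail L x k.+1)) +
     dn k * (b * (tail x k.+1 - tail x k.+2))).
Proof.
move=> L0 LN fup fdn; have N0 : (0 < N)%N by apply: leq_trans LN.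
rewrite /generator.
have -> : \sum_(k < n) N%:R *
    (up k * (a * (sample_tail L x k - sample_tail L x k.+1)) +
     dn k * (b * (tail x k.+1 - tail x k.+2))) =
  \sum_(k < n) up k * (N%:R * (a * sample_tail L x k) -
                       N%:R * (a * sample_tail L x k.+1)) +
  \sum_(k < n) dn k * (N%:R * (b * tail x k.+1) - N%:R * (b * tail x k.+2)).
  by rewrite -big_split; apply: eq_bigr => k _ /=; ring.
congr (_ + _).
  under [RHS]eq_bigr => k _ do rewrite -!(sum_arrivals _ _ _ L0 LN) -sumrB mulr_sumr.
  rewrite exchange_big/=; apply: eq_bigr => A _.
  under [in LHS]eq_bigr => i _ do rewrite fup mulr_sumr.
  rewrite exchange_big mulr_sumr; apply: eq_bigr => k _ /=.
  rewrite -mulrBr -sumrB mulrCA; congr (_ * _); rewrite mulr_sumr.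
  by apply: eq_bigr => i _; rewrite eq_natB; ring.
under [RHS]eq_bigr => k _ do rewrite -!(sum_services _ _ N0)// -sumrB mulr_sumr.
rewrite exchange_big/=; apply: eq_bigr => i xi.
rewrite (fdn _ xi) mulr_sumr; apply: eq_bigr => k _.
by rewrite eq_natB; ring.
Qed.

Lemma tail_add N (x : config N) i k : (0 < N)%N ->
  tail (add_customer x i) k.+1 = tail x k.+1 + (x i == k)%:R / N%:R.
Proof.
move=> N0; rewrite /tail -mulrDl; congr (_ / _).
rewrite -!sum1_card !natr_sum ![\sum_(_ in [set _ | _]%SET) _]big_mkcond/=.
rewrite (bigD1 i)//= [in RHS](bigD1 i)//= !inE ffunE eqxx ltnS addrAC.
congr (_ + _); first by case: ltngtP => _ //=; rewrite ?addr0 ?add0r.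
by apply: eq_bigr => j /negbTE ji; rewrite !inE ffunE ji.
Qed.

Lemma tail_remove N (x : config N) i k : (0 < N)%N -> (0 < x i)%N ->
  tail (remove_customer x i) k.+1 = tail x k.+1 - (x i == k.+1)%:R / N%:R.
Proof.
move=> N0 xi; rewrite /tail -mulrBl; congr (_ / _).
rewrite -!sum1_card !natr_sum ![\sum_(_ in [set _ | _]%SET) _]big_mkcond/=.
rewrite (bigD1 i)//= [in RHS](bigD1 i)//= !inE ffunE eqxx addrAC.
congr (_ + _); last by apply: eq_bigr => j /negbTE ji; rewrite !inE ffunE ji.
case: (x i) xi => // m _ /=; rewrite ltnS eqSS.
by case: ltngtP => _ //=; rewrite ?subr0 ?subrr.
Qed.

Lemma tail_ge0 N (x : config N) k : 0 <= tail x k.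
Proof. exact: divr_ge0. Qed.

Lemma card_tail_le N (x : config N) k : (#|[set i | (k <= x i)%N]%SET| <= N)%N.
Proof. by rewrite -[leqRHS]card_ord max_card. Qed.

Lemma card_tailS N (x : config N) k :
  (#|[set i | (k < x i)%N]%SET| <= #|[set i | (k <= x i)%N]%SET|)%N.
Proof. by apply: subset_leq_card; apply/fintype.subsetP => i; rewrite !inE => /ltnW. Qed.

Lemma tail0 N (x : config N) : (0 < N)%N -> tail x 0 = 1.
Proof.
move=> N0; rewrite /tail (_ : [set _ | _]%SET = [set: 'I_N]%SET).
  by rewrite cardsT card_ord divff// pnatr_eq0 -lt0n.
by apply/setP => i; rewrite !inE.
Qed.

Lemma tailS N (x : config N) k : tail x k.+1 <= tail x k.
Proof. by rewrite ler_wpM2r ?invr_ge0// ler_nat card_tailS. Qed.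

Lemma tail_le1 N (x : config N) k : tail x k <= 1.
Proof.
rewrite /tail; have [N0|N0] := posnP N.
  by rewrite (_ : N%:R = 0) ?invr0 ?mulr0// [in LHS]N0.
by rewrite ler_pdivrMr ?ltr0n// mul1r ler_nat card_tail_le.
Qed.

Lemma sample_tail0 L N (x : config N) : (L <= N)%N -> sample_tail L x 0 = 1.
Proof.
move=> LN; rewrite /sample_tail (_ : [set _ | _]%SET = [set: 'I_N]%SET).
  by rewrite cardsT card_ord divff// pnatr_eq0 -lt0n bin_gt0.
by apply/setP => i; rewrite !inE.
Qed.

Lemma sample_tail_ge0 L N (x : config N) k : 0 <= sample_tail L x k.
Proof. exact: divr_ge0. Qed.

Lemma sample_tailS L N (x : config N) k : sample_tail L x k.+1 <= sample_tail L x k.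
Proof. by rewrite ler_wpM2r ?invr_ge0// ler_nat leq_bin2l// card_tailS. Qed.

(** Sampling without replacement, one draw at a time: after l hits, the next draw hits m - l queues
    out of n - l. *)
Lemma ratio_binS (m n l : nat) : (l < n)%N ->
  'C(m, l.+1)%:R / 'C(n, l.+1)%:R =
  'C(m, l)%:R / 'C(n, l)%:R * ((m - l)%:R / (n - l)%:R) :> R.
Proof.
move=> ln; have E j : 'C(j, l.+1)%:R = 'C(j, l)%:R * (j - l)%:R / l.+1%:R :> R.
  by rewrite -natrM mulnC -mul_bin_left natrM mulrC mulKf// pnatr_eq0.
have ? : (n - l)%:R != 0 :> R by rewrite pnatr_eq0 -lt0n subn_gt0.
have ? : 'C(n, l)%:R != 0 :> R by rewrite pnatr_eq0 -lt0n bin_gt0 ltnW.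
have ? : l.+1%:R != 0 :> R by rewrite pnatr_eq0.
by rewrite !E; field; apply/and3P.
Qed.

(** Each draw succeeds with a conditional probability below [tail x k] by at most 2L/N, as N >= 2L.
    The factor [tail x k] in the error is essential, since the error is later summed against growing
    weights. *)
Lemma sample_tail_bounds L N (x : config N) k :
  (0 < L)%N -> (L.*2 <= N)%N ->
  0 <= tail x k ^+ L - sample_tail L x k <= (L * L.*2)%:R / N%:R * tail x k.
Proof.
move=> L0 LN; have N0 : (0 < N)%N by rewrite (leq_trans _ LN)// double_gt0.
rewrite /sample_tail /tail; set m := #|_|.
have mN : (m <= N)%N := card_tail_le x k.
set v : R := m%:R / N%:R.
have v0 : 0 <= v by apply: divr_ge0.
have v1 : v <= 1 by rewrite ler_pdivrMr ?ltr0n// mul1r ler_nat.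
(* The induction also carries the bound by [v], from which the error of each further draw inherits
   its factor [v]. *)
suff H l : (l < L)%N -> 'C(m, l.+1)%:R / 'C(N, l.+1)%:R <= v /\
    0 <= v ^+ l.+1 - 'C(m, l.+1)%:R / 'C(N, l.+1)%:R
      <= (l.+1 * L.*2)%:R / N%:R * v.
  by case: L L0 {LN} H => // l _ H; case: (H l (ltnSn l)).
elim: l => [_|l IH lL].
  by rewrite !bin1 expr1 -/v subrr; do !split => //; rewrite lexx mulr_ge0// divr_ge0.
have [qv /andP[q0 qle]] := IH (ltnW lL).
have lN : (l.+1 < N)%N.
  by rewrite (leq_trans lL)// (leq_trans _ LN)// -addnn leq_addr.
rewrite (ratio_binS _ lN).
set q := 'C(m, l.+1)%:R / _ in q0 qv qle *.
have qge0 : 0 <= q by apply: divr_ge0.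
set w := (m - l.+1)%:R / _.
have Nl0 : 0 < (N - l.+1)%:R :> R by rewrite ltr0n subn_gt0.
have w0 : 0 <= w by apply: divr_ge0.
have NR : 0 < N%:R :> R by rewrite ltr0n.
have wv : w <= v.
  rewrite ler_pdivrMr// mulrAC ler_pdivlMr// -!natrM ler_nat.
  by rewrite mulnBr mulnBl leq_sub2l// mulnC leq_mul2l mN orbT.
have vw : v - w <= L.*2%:R / N%:R.
  rewrite ler_pdivlMr// -(ler_pM2r Nl0).
  have wE : w * (N - l.+1)%:R = (m - l.+1)%:R by rewrite /w divfK ?gt_eqF.
  have vE : v * N%:R = m%:R by rewrite /v divfK ?gt_eqF.
  rewrite mulrBl vE mulrBl mulrAC wE.
  have mj : m%:R <= (m - l.+1)%:R + l.+1%:R :> R by rewrite -natrD ler_nat addnC -leq_subLR.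
  have mNR : m%:R <= N%:R :> R by rewrite ler_nat.
  have lLR : l.+1%:R <= L%:R :> R by rewrite ler_nat ltnW.
  have LNR : L%:R + L%:R <= N%:R :> R by rewrite -natrD addnn ler_nat.
  have l0 : 0 <= l.+1%:R :> R by [].
  have m0 : 0 <= m%:R :> R by [].
  rewrite (natrB _ (ltnW lN)) -addnn natrD; nra.
rewrite exprS.
have -> : v * v ^+ l.+1 - q * w = v * (v ^+ l.+1 - q) + q * (v - w) by ring.
have qw : q * w <= v * 1 by apply: ler_pM => //; apply: le_trans v1.
have A1 : v * (v ^+ l.+1 - q) <= v ^+ l.+1 - q by rewrite ler_piMl.
have A2 : q * (v - w) <= v * (L.*2%:R / N%:R) by rewrite ler_pM// subr_ge0.
have A3 : 0 <= v * (v ^+ l.+1 - q) by rewrite mulr_ge0.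
have A4 : 0 <= q * (v - w) by rewrite mulr_ge0// subr_ge0.
rewrite mulr1 in qw; split=> //; apply/andP; split; first exact: addr_ge0.
rewrite (mulSn l.+1) natrD; lra.
Qed.
End Combinatorics.

(** * Stationarity and the generator *)

Section Mean.
Context {R : realType} {d : measure_display} {Omega : measurableType d}.
Variables (P : probability Omega R) (N : nat) (Y : Omega -> config N).
Hypothesis mY : forall x, measurable [set w | Y w = x].
Implicit Types f g : config N -> R.

Definition bdd f := exists M, forall x, `|f x| <= M.

Lemma measurable_comp_config f : measurable_fun setT (f \o Y).
Proof.
move=> _ B _; rewrite setTI (_ : _ @^-1` B =
    \bigcup_x [set w | Y w = x /\ B (f x)]); last first.
  by apply/seteqP; split => [w Bw|w [x _ [<-]]//]; exists (Y w).
apply: countable_bigcupT_measurable => [|x].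
  exact: (@countableP {ffun 'I_N -> nat}).
have [Bx|Bx] := pselect (B (f x)).
  rewrite (_ : [set w | _] = [set w | Y w = x])//.
  by apply/seteqP; split => w //= [].
by rewrite (_ : [set w | _] = set0)//; apply/seteqP; split => w //= [].
Qed.

Lemma integrable_comp_config f : bdd f -> P.-integrable setT (EFin \o (f \o Y)).
Proof.
move=> [M fM]; apply: measurable_bounded_integrable => //.
- by rewrite (le_lt_trans (probability_le1 _ _))// ltry.
- exact: measurable_comp_config.
- exists M; split; first exact: num_real.
  by move=> z Mz w _ /=; rewrite (le_trans (fM _))// ltW.
Qed.

(** A real expectation is enough for the Lyapunov argument, all test functions being bounded;
    extended reals return only with the infinite series of the norm. *)
Definition mean f : R := (\int[P]_w f (Y w))%R.

Lemma meanD f g : bdd f -> bdd g -> mean (fun x => f x + g x) = mean f + mean g.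
Proof. by move=> *; rewrite /mean RintegralD//; exact: integrable_comp_config. Qed.

Lemma meanZ c f : bdd f -> mean (fun x => c * f x) = c * mean f.
Proof. by move=> *; rewrite /mean RintegralZl//; exact: integrable_comp_config. Qed.

Lemma le_mean f g : bdd f -> bdd g -> (forall x, f x <= g x) -> mean f <= mean g.
Proof.
by move=> ? ? fg; apply: le_Rintegral => //; exact: integrable_comp_config.
Qed.

Lemma mean_cst c : mean (fun=> c) = c.
Proof.
rewrite /mean /Rintegral integral_cst// -[RHS]/(fine c%:E) -[in RHS](mule1 c%:E).
by congr (fine (_ * _)%E); exact: probability_setT.
Qed.

Lemma mean_ge0 f : (forall x, 0 <= f x) -> 0 <= mean f.
Proof. by move=> f0; apply: Rintegral_ge0. Qed.

Lemma EFin_mean f : bdd f -> (mean f)%:E = (\int[P]_w (f (Y w))%:E)%E.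
Proof.
move=> bf; rewrite /mean /Rintegral fineK//.
by apply: integrable_fin_num => //; exact: integrable_comp_config.
Qed.

Lemma bdd_cst c : bdd (fun=> c).
Proof. by exists `|c|. Qed.

Lemma bddD f g : bdd f -> bdd g -> bdd (fun x => f x + g x).
Proof.
move=> [M fM] [M' gM]; exists (M + M') => x.
by rewrite (le_trans (ler_normD _ _))// lerD.
Qed.

Lemma bddM f g : bdd f -> bdd g -> bdd (fun x => f x * g x).
Proof.
by move=> [M fM] [M' gM]; exists (M * M') => x; rewrite normrM ler_pM.
Qed.

Lemma bdd_sum n (F : nat -> config N -> R) :
  (forall k, bdd (F k)) -> bdd (fun x => \sum_(k < n) F k x).
Proof.
move=> bF; elim: n => [|n IH].
  by exists 0 => x; rewrite big_ord0 normr0.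
have [M H] := bddD IH (bF n); exists M => x; rewrite big_ord_recr/=; exact: H.
Qed.

Lemma mean_sum n (F : nat -> config N -> R) : (forall k, bdd (F k)) ->
  mean (fun x => \sum_(k < n) F k x) = \sum_(k < n) mean (F k).
Proof.
move=> bF; elim: n => [|n IH].
  rewrite big_ord0 -[RHS](mean_cst 0); congr mean.
  by apply/funext => x; rewrite big_ord0.
rewrite big_ord_recr/= -IH -meanD//; last exact: bdd_sum.
by congr mean; apply/funext => x; rewrite big_ord_recr.
Qed.

Lemma mean_cvg0 (F : nat -> config N -> R) M :
  (forall k x, `|F k x| <= M) -> (forall x, F ^~ x @ \oo --> 0) ->
  mean (F k) @[k --> \oo] --> 0.
Proof.
move=> FM F0.
have [||||| _ _] := @dominated_convergence _ _ _ P setT measurableT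
   (fun k w => (F k (Y w))%:E) (cst 0%E) (cst M%:E).
- by move=> k; apply/measurable_EFinP; exact: measurable_comp_config.
- exact: measurable_cst.
- apply: aeW => w _; by apply: cvg_EFin; [exact: nearW|exact: F0].
- apply: (@integrable_comp_config (fun=> M)); exact: bdd_cst.
- by apply: aeW => w k _; rewrite lee_fin.
by rewrite integral_cst// mul0e => /fine_cvg.
Qed.

End Mean.

Section Semigroup.
Context {R : realType}.
Variables (a b : R) (L N : nat).
Hypotheses (a_ge0 : 0 <= a) (b_ge0 : 0 <= b) (L_gt0 : (0 < L)%N) (LN : (L <= N)%N).
Implicit Types f : config N -> R.

Lemma generator_bound f M : (forall x, `|f x| <= M) ->
  forall x, `|generator a b L f x| <= 2 * N%:R * (a + b) * M.
Proof.
move=> fM x; have M0 : 0 <= M by apply: le_trans (fM x).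
have fB y : `|f y - f x| <= 2 * M.
  by rewrite mulr_natl mulr2n (le_trans (ler_normB _ _))// lerD.
have NR : 0 <= N%:R :> R by [].
have -> : 2 * N%:R * (a + b) * M = N%:R * a * (2 * M) + N%:R * b * (2 * M) by ring.
rewrite (le_trans (ler_normD _ _))// lerD//.
  rewrite (le_trans (ler_norm_sum _ _ _))//.
  pose g := N%:R * a / 'C(N, L)%:R * (2 * M).
  apply: (@le_trans _ _ (\sum_(A : {set 'I_N} | #|A| == L) g)).
    apply: ler_sum => A /eqP cA; rewrite normrM ger0_norm ?mulr_ge0 ?divr_ge0//.
    rewrite ler_wpM2l ?mulr_ge0// (le_trans (ler_norm_sum _ _ _))//.
    (* The indicator of [0 <= x i] is 1; it is inserted so that [sum_shortest] at level 0 sums the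
       tie-breaking weights. *)
    pose h (i : 'I_N) := (#|shortest x A|%:R)^-1 * (0 <= x i)%N%:R * (2 * M).
    apply: (@le_trans _ _ (\sum_(i in shortest x A) h i)).
      apply: ler_sum => i _; rewrite /h leq0n mulr1 normrM.
      by rewrite ger0_norm ?invr_ge0// ler_wpM2l ?invr_ge0.
    rewrite -mulr_suml (sum_shortest _ _ L_gt0 cA); case: (_ \subset _) => /=.
      by rewrite mul1r.
    by rewrite mul0r mulr_ge0.
  rewrite sumr_const.
  have -> : #|(fun A : {set 'I_N} => #|A| == L)| = 'C(N, L).
    by rewrite -[X in 'C(X, _)]card_ord -card_draws cardsE.
  have C0 : 'C(N, L)%:R != 0 :> R by rewrite pnatr_eq0 -lt0n bin_gt0.
  by rewrite -mulr_natr le_eqVlt; apply/orP; left; apply/eqP; rewrite /g; field.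
rewrite (le_trans (ler_norm_sum _ _ _))//.
apply: (@le_trans _ _ (\sum_(i < N) b * (2 * M))).
  rewrite big_mkcond; apply: ler_sum => i _; case: ifP => _.
    by rewrite normrM ger0_norm// ler_wpM2l.
  by rewrite !mulr_ge0.
by rewrite sumr_const card_ord -[leLHS]mulr_natl mulrA.
Qed.

Lemma iter_generator_bound f M n : (forall x, `|f x| <= M) ->
  forall x, `|iter n (generator a b L (N := N)) f x|
            <= (2 * N%:R * (a + b)) ^+ n * M.
Proof.
move=> fM; elim: n => [|n IH] x; first by rewrite mul1r.
by rewrite iterS exprS -mulrA; exact: generator_bound.
Qed.

(** The n-th term of the exponential series is at most M q^n with q = 2N(a+b)t <= 1/2, so the terms
    of order two and more add up to at most M q^2/(1-q) <= 2 M q^2. *)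
Lemma semigroup_taylor f M t x : (forall x, `|f x| <= M) -> 0 <= t ->
  2 * N%:R * (a + b) * t <= 1/2 ->
  `|semigroup a b L t f x - (f x + t * generator a b L f x)|
    <= 2 * M * (2 * N%:R * (a + b)) ^+ 2 * t ^+ 2.
Proof.
move=> fM t0; set l := 2 * N%:R * (a + b) => lt2.
have M0 : 0 <= M by apply: le_trans (fM x).
have l0 : 0 <= l by rewrite !mulr_ge0// addr_ge0.
pose q := l * t; have q0 : 0 <= q by rewrite mulr_ge0.
pose u n := t ^+ n / n`!%:R * iter n (generator a b L (N := N)) f x.
have uq n : `|u n| <= M * q ^+ n.
  rewrite normrM ger0_norm ?divr_ge0 ?exprn_ge0//.
  have := iter_generator_bound n fM x; rewrite -/l => G.
  rewrite (@le_trans _ _ (t ^+ n * (l ^+ n * M)))//; last first.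
    by rewrite /q [in leRHS]exprMn; lra.
  rewrite ler_pM ?divr_ge0 ?exprn_ge0// ler_pdivrMr ?ltr0n ?fact_gt0//.
  by rewrite ler_peMr ?exprn_ge0// ler1n fact_gt0.
have cu : cvgn (series u).
  apply: normed_cvg; apply: (@series_le_cvg _ _ (geometric M q)) => //.
  - by move=> n /=.
  - by move=> n /=; rewrite mulr_ge0 ?exprn_ge0.
  - apply: is_cvg_geometric_series; rewrite ger0_norm//; rewrite /q; lra.
(* The factor 1 - q^n makes the bound inductive: a new term M q^(n+2) fits into its increment
   because q <= 1/2. *)
have B n : `|series u n.+2 - (u 0 + u 1)| <= 2 * M * q ^+ 2 * (1 - q ^+ n).
  elim: n => [|n IH].
    by rewrite /series/= big_nat_recr//= big_nat1 subrr normr0 expr0 subrr mulr0.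
  have -> : series u n.+3 - (u 0 + u 1) = (series u n.+2 - (u 0 + u 1)) + u n.+2.
    by rewrite seriesSr addrAC.
  rewrite (le_trans (ler_normD _ _))//.
  have z0 : 0 <= M * (q ^+ 2 * q ^+ n) by rewrite mulr_ge0 // mulr_ge0 ?exprn_ge0.
  have := uq n.+2; rewrite -addn2 addnC exprD (exprS q n) => H.
  have qlt : q <= 1/2 by [].
  have : M * (q ^+ 2 * q ^+ n) * q <= M * (q ^+ 2 * q ^+ n) * (1/2).
    by rewrite ler_wpM2l.
  by lra.
have -> : f x + t * generator a b L f x = u 0 + u 1.
  by rewrite /u/= expr0 expr1 !divr1 mul1r.
have -> : 2 * M * l ^+ 2 * t ^+ 2 = 2 * M * q ^+ 2 by rewrite /q; ring.
have Mq : 0 <= 2 * M * q ^+ 2 by apply: mulr_ge0; [exact: mulr_ge0|exact: exprn_ge0].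
have c : (fun n => `|series u n - (u 0 + u 1)|) @ \oo -->
    `|semigroup a b L t f x - (u 0 + u 1)|.
  by apply: cvg_norm; apply: cvgB => //; exact: cvg_cst.
apply: (cvgr_to_le c); near=> n.
have n2 : (2 <= n)%N by near: n; exact: nbhs_infty_ge.
rewrite -(subnK n2) addn2 (le_trans (B _))//.
by apply: ler_piMr => //; rewrite gerBl exprn_ge0.
Unshelve. all: by end_near.
Qed.
End Semigroup.

Section Stationarity.
Context {R : realType} {d : measure_display} {Omega : measurableType d}.
Variables (a b : R) (L N : nat) (P : probability Omega R).
Variable X : R -> Omega -> config N.
Hypotheses (a_ge0 : 0 <= a) (b_ge0 : 0 <= b) (L_gt0 : (0 < L)%N) (LN : (L <= N)%N).
Hypothesis Xqueue : queue_length_process a b L P X.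
Hypothesis Xinv : starts_from_invariant_law P X.

Lemma measurable_initial x : measurable [set w | X 0 w = x].
Proof. by apply: Xqueue.1. Qed.

Lemma bdd_generator (f : config N -> R) : bdd f -> bdd (generator a b L f).
Proof. by move=> [M fM]; eexists; exact: generator_bound fM. Qed.

(** Invariance is assumed for the law of the tail process, not of the configuration, hence test
    functions that factor through [tail]. Both means are integrals against the image law on the
    reals. *)
Lemma mean_invariant (F : (nat -> R) -> R) t : 0 <= t ->
  bdd (fun x : config N => F (tail x)) ->
  mean P (X t) (fun x => F (tail x)) = mean P (X 0) (fun x => F (tail x)).
Proof.
move=> t0 bF; pose f (x : config N) := F (tail x).
have mX s : 0 <= s -> measurable_fun setT (f \o X s).
  by move=> s0; apply: measurable_comp_config => x; exact: Xqueue.1.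
pose Y s (s0 : 0 <= s) : {RV P >-> R} :=
  HB.pack (f \o X s) (isMeasurableFun.Build _ _ _ _ _ (mX s s0)).
have E s (s0 : 0 <= s) : mean P (X s) f =
    fine (\int[distribution P (Y s s0)]_y y%:E)%E.
  rewrite integral_distribution//.
  by apply: integrable_comp_config => // x; exact: Xqueue.1.
rewrite (E t t0) (E 0 (lexx 0)); congr fine; apply: eq_measure_integral => B mB _.
exact: (Xinv t0 [set v | B (F v)]).
Qed.

(** The semigroup preserves the stationary mean of f, so the second-order expansion gives t |E(Q f)|
    <= c t^2 for all small t, where Q is the generator; hence E(Q f) = 0. *)
Lemma mean_generator (F : (nat -> R) -> R) :
  bdd (fun x : config N => F (tail x)) ->
  mean P (X 0) (generator a b L (fun x => F (tail x))) = 0.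
Proof.
move=> [M fM]; set f := fun x => _.
set l := 2 * N%:R * (a + b).
have bf : bdd f by exists M.
have bG := bdd_generator bf.
have l0 : 0 <= l by rewrite !mulr_ge0// addr_ge0.
have step t : 0 <= t -> l * t <= 1/2 ->
    t * `|mean P (X 0) (generator a b L f)| <= 2 * M * l ^+ 2 * t ^+ 2.
  move=> t0 lt2; have T x := semigroup_taylor a_ge0 b_ge0 L_gt0 LN x fM t0 lt2.
  have bS : bdd (semigroup a b L t f).
    exists (`|M| + `|t * (l * M)| + `|2 * M * l ^+ 2 * t ^+ 2|) => x.
    have := T x; have := fM x; have := generator_bound a_ge0 b_ge0 L_gt0 LN fM x.
    rewrite -/l -/f => G fx Tx.
    rewrite -(subrK (f x + t * generator a b L f x) (semigroup a b L t f x)) addrC.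
    rewrite (le_trans (ler_normD _ _))// lerD//; last first.
      exact: le_trans (ler_norm _).
    rewrite (le_trans (ler_normD _ _))// lerD//.
      by rewrite (le_trans fx)// ler_norm.
    by rewrite normrM [leRHS]normrM ler_wpM2l// (le_trans G)// ler_norm.
  have : mean P (X 0) (semigroup a b L t f) = mean P (X 0) f.
    rewrite -(mean_invariant t0 bf).
    have := Xqueue.2 0 t (lexx 0) t0 setT; rewrite add0r => H.
    congr fine; symmetry; apply: H bf.
    exact: (@measurableT _ (g_sigma_algebraType _)).
  move=> ES.
  pose D x := semigroup a b L t f x + -1 * (f x + t * generator a b L f x).
  have bt : bdd (fun x => t * generator a b L f x) by apply: bddM => //; exact: bdd_cst.
  have bft : bdd (fun x => f x + t * generator a b L f x) by exact: bddD.
  have bD1 : bdd (fun x => -1 * (f x + t * generator a b L f x)).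
    by apply: bddM => //; exact: bdd_cst.
  have bD : bdd D by exact: bddD.
  have mE : mean P (X 0) D = - (t * mean P (X 0) (generator a b L f)).
    rewrite /D (meanD _ measurable_initial)// ES (meanZ _ measurable_initial)//.
    rewrite (meanD _ measurable_initial)// (meanZ _ measurable_initial)//; ring.
  rewrite -[X in X * _](ger0_norm t0) -normrM -normrN -mE ler_norml.
  have DT x : - (2 * M * l ^+ 2 * t ^+ 2) <= D x <= 2 * M * l ^+ 2 * t ^+ 2.
    by rewrite -ler_norml /D mulN1r.
  apply/andP; split.
    rewrite -[leLHS](mean_cst P (X 0)); apply: (le_mean _ measurable_initial) => //.
      exact: bdd_cst.
    by move=> x; case/andP: (DT x).
  rewrite -[leRHS](mean_cst P (X 0)); apply: (le_mean _ measurable_initial) => //.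
    exact: bdd_cst.
  by move=> x; case/andP: (DT x).
apply/eqP; rewrite -normr_eq0 eq_le normr_ge0 andbT leNgt; apply/negP => m0.
set m := `|_| in m0 step; set c := 2 * M * l ^+ 2 in step.
have c0 : 0 <= c.
  rewrite mulr_ge0 ?exprn_ge0// mulr_ge0//.
  by apply: le_trans (fM [ffun => 0%N]).
have lm : 0 <= l * m by rewrite mulr_ge0// ltW.
clearbody c m l.
have den : 0 < 2 * (l * m + c + 1) by lra.
(* This t satisfies both l t <= 1/2 and c t < m, which contradicts t m <= c t^2. *)
have t0 : 0 < m / (2 * (l * m + c + 1)) by rewrite divr_gt0.
have lt2 : l * (m / (2 * (l * m + c + 1))) <= 1 / 2.
  by rewrite mulrA ler_pdivrMr//; lra.
have := step _ (ltW t0) lt2; rewrite expr2 mulrCA ler_pM2l//.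
by rewrite mulrA ler_pdivlMr//; nra.
Qed.
End Stationarity.

(** * Contraction of a weighted l^1 norm *)

Section Weights.
Context {R : realType}.
Implicit Types q r rho : R.

Lemma geometric_sum_le q n : 0 <= q < 1 -> \sum_(k < n) q ^+ k <= (1 - q)^-1.
Proof.
move=> /andP[q0 q1]; have q1' : 0 < 1 - q by rewrite subr_gt0.
rewrite -[leRHS]mul1r ler_pdivlMr// mulrC.
have := subrX1 q n; set S := \sum_(_ < _) _ => E.
have := exprn_ge0 n q0; nra.
Qed.

Lemma sum_le_geometric q D (F : nat -> R) n : 0 <= q < 1 -> 0 <= D ->
  (forall k, F k <= D * q ^+ k) -> \sum_(k < n) F k <= D * (1 - q)^-1.
Proof.
move=> q01 D0 FD; apply: (@le_trans _ _ (\sum_(k < n) D * q ^+ k)).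
  exact: ler_sum.
by rewrite -mulr_sumr ler_wpM2l// geometric_sum_le.
Qed.

Lemma geometric_sum_gt1_le r n : 1 < r -> \sum_(k < n) r ^+ k <= r ^+ n / (r - 1).
Proof.
move=> r1; have r1' : 0 < r - 1 by rewrite subr_gt0.
by rewrite ler_pdivlMr// mulrC -subrX1 gerBl.
Qed.

Lemma u_tilde0 rho L : u_tilde rho L 0 = 1.
Proof. by rewrite /u_tilde big_ord0. Qed.

Lemma u_tildeS rho L k : u_tilde rho L k.+1 = rho * u_tilde rho L k ^+ L.
Proof.
rewrite /u_tilde -exprM -exprS big_ord_recl; congr (_ ^+ _).
by rewrite mulnC big_distrr/= add1n; congr _.+1; apply: eq_bigr => i _; rewrite expnS.
Qed.

Lemma u_tilde_gt0 rho L k : 0 < rho -> 0 < u_tilde rho L k.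
Proof. by move=> rho0; apply: exprn_gt0. Qed.

Lemma u_tilde_le rho L k : 0 <= rho <= 1 -> (0 < L)%N -> u_tilde rho L k <= rho ^+ k.
Proof.
move=> rho01 L0; apply: ler_wiXn2l; rewrite ?(andP rho01).1 ?(andP rho01).2//.
rewrite -[leqLHS]card_ord -sum1_card; apply: leq_sum => i _.
by rewrite expn_gt0 L0.
Qed.

(** For L >= 2 the exponent 1 + L + ... + L^(k-1) is at least 2k - 1. This allows s = rho instead of
    s = sqrt rho. *)
Lemma u_tilde_le_sqr rho L k : 0 < rho <= 1 -> (1 < L)%N ->
  u_tilde rho L k <= rho^-1 * (rho ^+ 2) ^+ k.
Proof.
move=> /andP[rho0 rho1] L1; rewrite mulrC ler_pdivlMr// mulrC -exprM -exprS.
apply: ler_wiXn2l => //; first exact: ltW.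
elim: k => [|k IH]; first by rewrite big_ord0.
rewrite big_ord_recr/= mulnSr; case: k IH => [|k] IH; first by rewrite big_ord0.
rewrite -addSn leq_add// expnS (leq_trans L1)// leq_pmulr// expn_gt0.
by rewrite (leq_trans _ L1).
Qed.

(* The increments e_k = W_(k+1) - W_k satisfy e_(k+1) (1 + (L-1) u_(k+1)) = r e_k, so
   that they are r^k up to a convergent product. *)
Lemma exists_weights rho r L : 0 < rho < 1 -> (0 < L)%N -> 1 < r -> rho * r < 1 ->
  exists W : nat -> R, exists kappa gamma C : R,
  [/\ 0 < gamma, 0 < C, W 0 = 0, forall k, W k <= W k.+1 &
  [/\ forall k, W k.+2 <= kappa * W k.+1, forall k, r ^+ k <= C * W k.+1,
     forall k, W k <= C * r ^+ k &
  forall k, rho * (1 + L.-1%:R * u_tilde rho L k.+1) * (W k.+2 - W k.+1)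
            - (W k.+1 - W k) <= - gamma * W k.+1]].
Proof.
move=> /andP[rho0 rho1] L0 r1 rhor.
pose g j := 1 + L.-1%:R * u_tilde rho L j.+1.
have u0 j : 0 <= u_tilde rho L j by rewrite ltW// u_tilde_gt0.
have g1 j : 1 <= g j by rewrite lerDl mulr_ge0.
have g0 j : 0 < g j by apply: lt_le_trans (g1 j).
pose Pi k := \prod_(j < k) g j.
have Pi1 k : 1 <= Pi k.
  elim: k => [|k IH]; first by rewrite /Pi big_ord0.
  by rewrite /Pi big_ord_recr/= (le_trans IH)// ler_peMr// (le_trans _ IH).
have Pi0 k : 0 < Pi k by apply: lt_le_trans (Pi1 k).
(* Bounds the product through 1 + x <= exp x and u(j) <= rho^j. *)
pose D := expR (L.-1%:R * (1 - rho)^-1).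
have D0 : 0 < D by apply: expR_gt0.
have PiD k : Pi k <= D.
  apply: (@le_trans _ _ (expR (L.-1%:R * \sum_(j < k) u_tilde rho L j.+1))).
    elim: k => [|k IH]; first by rewrite /Pi !big_ord0 mulr0 expR0.
    rewrite /Pi !big_ord_recr/= [in leRHS]mulrDr expRD ler_pM//.
    - exact: ltW (Pi0 k).
    - exact: ltW (g0 k).
    - exact: expR_ge1Dx.
  rewrite ler_expR ler_wpM2l//.
  apply: le_trans (geometric_sum_le k _); last by rewrite ltW.
  apply: ler_sum => j _; apply: le_trans (u_tilde_le _ _ _) _ => //.
    by rewrite !ltW.
  by rewrite exprS ler_piMl ?exprn_ge0// ltW.
pose e k := r ^+ k / Pi k.
have r0 : 0 < r by apply: lt_trans r1.
have rm1 : 0 < r - 1 by rewrite subr_gt0.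
have e0 k : 0 < e k by rewrite divr_gt0 ?exprn_gt0.
have eS k : e k.+1 * g k = e k * r.
  rewrite /e /Pi big_ord_recr/= -/(Pi k) exprS; have := Pi0 k; have := g0 k.
  by move=> /lt0r_neq0 ? /lt0r_neq0 ?; field; apply/andP.
have eD k : r ^+ k <= D * e k.
  by rewrite /e mulrA ler_pdivlMr// mulrC ler_pM2r ?exprn_gt0.
have er k : e k <= r ^+ k.
  by rewrite /e ler_pdivrMr// ler_peMr// exprn_ge0// ltW.
pose W k := \sum_(j < k) e j.
have WS k : W k.+1 = W k + e k by rewrite /W big_ord_recr.
have W0 : W 0 = 0 by rewrite /W big_ord0.
have Wge0 k : 0 <= W k by apply: sumr_ge0 => j _; exact: ltW.
have eW k : e k <= W k.+1 by rewrite WS lerDr.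
have Wr k : W k <= r ^+ k / (r - 1).
  by apply: le_trans (geometric_sum_gt1_le _ r1); apply: ler_sum => j _.
(* The increments grow like r^k with r > 1, so a weight is at most a constant times its last
   increment. *)
pose K := D * r / (r - 1).
have K0 : 0 < K by rewrite divr_gt0// mulr_gt0.
have WK k : W k.+1 <= K * e k.
  apply: le_trans (Wr _) _; rewrite /K mulrAC ler_wpM2r ?invr_ge0 ?(ltW rm1)//.
  by rewrite exprS mulrAC mulrC ler_wpM2r ?(ltW r0)// .
exists W, (1 + r), ((1 - rho * r) / K), (D + (r - 1)^-1).
split => //.
- by rewrite divr_gt0// subr_gt0.
- by rewrite addr_gt0// invr_gt0.
- by move=> k; rewrite WS lerDl ltW.
split.
- move=> k; rewrite WS mulrDl mul1r lerD2l.
  have : e k.+1 <= e k * r by rewrite -eS ler_peMr// ltW.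
  by move=> /le_trans; apply; rewrite mulrC ler_pM2l.
- move=> k; apply: (le_trans (eD k)); rewrite mulrDl.
  apply: (@le_trans _ _ (D * W k.+1)); first by rewrite ler_pM2l.
  by rewrite lerDl mulr_ge0// invr_ge0 ltW.
- move=> k; apply: (le_trans (Wr k)); rewrite mulrC ler_wpM2r ?exprn_ge0// ?ltW//.
  by rewrite ltrDr.
(* By the recursion for the increments the left-hand side is exactly -(1 - rho r) e_k, and [WK]
   converts e_k into the weight itself. *)
- move=> k; rewrite -/(g k) (WS k.+1) (WS k) -(WS k).
  have -> : W k.+1 + e k.+1 - W k.+1 = e k.+1 by ring.
  have -> : W k.+1 - W k = e k by rewrite WS; ring.
  rewrite -mulrA [g k * _]mulrC eS mulrCA.
  have -> : e k * (rho * r) - e k = - ((1 - rho * r) * e k) by ring.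
  rewrite mulNr lerN2 mulrAC ler_pdivrMr// -mulrA ler_pM2l ?subr_gt0//.
  by rewrite mulrC WK.
Qed.

End Weights.

(** * Smoothing of the absolute value *)

Section SmoothAbs.
Context {R : realType}.
Implicit Types y h e : R.

(** The Euclidean norm of the vector (y, e): 1-Lipschitz in y, within e of |y|, and with second
    derivative at most 1/e. *)
Definition smooth_abs e y := Num.sqrt (y ^+ 2 + e ^+ 2).

Lemma smooth_abs_sqr e y : smooth_abs e y ^+ 2 = y ^+ 2 + e ^+ 2.
Proof. by rewrite sqr_sqrtr// addr_ge0// sqr_ge0. Qed.

Lemma smooth_abs_gt0 e y : 0 < e -> 0 < smooth_abs e y.
Proof. by move=> e0; rewrite sqrtr_gt0 ltr_wpDl ?sqr_ge0 ?exprn_gt0. Qed.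

Lemma smooth_abs_ge e y : `|y| <= smooth_abs e y.
Proof. by rewrite -sqrtr_sqr ler_wsqrtr// lerDl sqr_ge0. Qed.

Lemma smooth_abs_gee e y : 0 <= e -> e <= smooth_abs e y.
Proof. by move=> e0; rewrite -[leLHS]ger0_norm// -sqrtr_sqr ler_wsqrtr// lerDr sqr_ge0. Qed.

Lemma smooth_abs_le e y : 0 <= e -> smooth_abs e y <= `|y| + e.
Proof.
move=> e0; rewrite -(@ler_pXn2r _ 2)// ?nnegrE ?sqrtr_ge0 ?addr_ge0//.
rewrite smooth_abs_sqr sqrrD real_normK ?num_real// lerD2r lerDl mulrn_wge0//.
by rewrite mulr_ge0.
Qed.

Lemma smooth_abs_slope_le1 e y : 0 < e -> `|y / smooth_abs e y| <= 1.
Proof.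
move=> e0; have z0 := smooth_abs_gt0 y e0.
by rewrite normrM normfV (gtr0_norm z0) ler_pdivrMr// mul1r smooth_abs_ge.
Qed.

(** With z = [smooth_abs e y], y^2/z = z - e^2/z, and z dominates both |y| and e. The slope
    therefore acts as the sign of y up to an error e. *)
Lemma smooth_abs_slope_ge e y : 0 < e -> `|y| - e <= y * (y / smooth_abs e y).
Proof.
move=> e0; have z0 := smooth_abs_gt0 y e0.
apply: (@le_trans _ _ (smooth_abs e y - e)).
  by rewrite lerD2r smooth_abs_ge.
rewrite mulrA ler_pdivlMr// -expr2.
have -> : y ^+ 2 = smooth_abs e y ^+ 2 - e ^+ 2 by rewrite smooth_abs_sqr; ring.
have := smooth_abs_gee y (ltW e0); nra.
Qed.

(** With z and z' the values at y and y + h, 2 z z' <= z^2 + z'^2 bounds z' by a quadratic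
    polynomial in h with leading coefficient 1/(2z) <= 1/(2e). *)
Lemma smooth_abs_taylor e y h : 0 < e ->
  smooth_abs e (y + h) <= smooth_abs e y + y / smooth_abs e y * h + h ^+ 2 * (2 * e)^-1.
Proof.
move=> e0; have z0 := smooth_abs_gt0 y e0.
set z := smooth_abs e y in z0 *.
have zE : z ^+ 2 = y ^+ 2 + e ^+ 2 by exact: smooth_abs_sqr.
have ez : e <= z by exact: smooth_abs_gee (ltW e0).
apply: (@le_trans _ _ (z + y / z * h + h ^+ 2 * (2 * z)^-1)); last first.
  by rewrite lerD2l ler_wpM2l ?sqr_ge0// lef_pV2 ?posrE ?mulr_gt0// ler_pM2l.
have -> : z + y / z * h + h ^+ 2 * (2 * z)^-1 =
          (z ^+ 2 + ((y + h) ^+ 2 + e ^+ 2)) * (2 * z)^-1.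
  rewrite [in RHS]sqrrD mulr2n.
  have -> : y ^+ 2 + (y * h + y * h) + h ^+ 2 + e ^+ 2 =
            z ^+ 2 + 2 * y * h + h ^+ 2 by rewrite zE; ring.
  by field; rewrite gt_eqF.
rewrite -smooth_abs_sqr ler_pdivlMr ?mulr_gt0//.
have := sqr_ge0 (smooth_abs e (y + h) - z); nra.
Qed.

Lemma smooth_abs_lip e y h : 0 < e -> `|smooth_abs e (y + h) - smooth_abs e y| <= `|h|.
Proof.
move=> e0.
suff H a b : smooth_abs e (a + b) <= smooth_abs e a + `|b|.
  rewrite ler_norml; apply/andP; split; last by rewrite lerBlDl H.
  by have := H (y + h) (- h); rewrite addrK normrN; lra.
have z0 := smooth_abs_gt0 a e0.
rewrite -(@ler_pXn2r _ 2)// ?nnegrE ?sqrtr_ge0 ?addr_ge0 ?sqrtr_ge0//.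
rewrite smooth_abs_sqr [leRHS]sqrrD smooth_abs_sqr real_normK ?num_real// mulr2n.
have := ler_norm (a * b); rewrite normrM.
have := ler_wpM2r (normr_ge0 b) (smooth_abs_ge e a).
by rewrite sqrrD mulr2n; lra.
Qed.

End SmoothAbs.

Section CompartmentDrift.
Context {R : realType}.

(* x k is the flow from level k up to level k.+1, beta * y k.+1 the flow back, w the
   error in the linearization x = b y and e the error in s = sign y. *)
Lemma compartment_drift (W s y x b w e : nat -> R) (B beta : R) n :
  W 0 = 0 -> (forall k, W k <= W k.+1) -> 0 <= beta ->
  (forall k, `|s k| <= 1) -> (forall k, `|y k| - e k <= y k * s k) ->
  (forall k, `|x k - b k * y k| <= w k) -> (forall k, 0 <= b k <= B) ->
  (forall k, 0 <= e k) ->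
  x 0 = 0 -> 0 <= x n * s n.+1 ->
  \sum_(k < n) W k.+1 * s k.+1 * ((x k - x k.+1) - beta * (y k.+1 - y k.+2)) <=
  \sum_(k < n) ((b k.+1 * (W k.+2 - W k.+1) - beta * (W k.+1 - W k)) * `|y k.+1| +
     (B + beta) * (W k.+1 * e k.+1) + 2 * (W k.+2 * w k.+1)) + beta * (W n * `|y n.+1|).
Proof.
move=> W0 WS beta0 s1 ys xb bB e0 x0 xn.
have Wge0 k : 0 <= W k by elim: k => [|k IH]; [rewrite W0|apply: le_trans (WS k)].
(* The induction on n needs the flow entering level n+1 on the left; it is nonnegative at the final
   n and is dropped there. *)
suff H : \sum_(k < n) W k.+1 * s k.+1 * ((x k - x k.+1) - beta * (y k.+1 - y k.+2))
    + x n * s n.+1 * W n.+1 <=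
  \sum_(k < n) ((b k.+1 * (W k.+2 - W k.+1) - beta * (W k.+1 - W k)) * `|y k.+1| +
     (B + beta) * (W k.+1 * e k.+1) + 2 * (W k.+2 * w k.+1)) + beta * (W n * `|y n.+1|).
  by apply: le_trans H; rewrite lerDl mulr_ge0.
elim: n {xn} => [|n IH].
  by rewrite !big_ord0 x0 W0 !(mul0r, mulr0) addr0.
rewrite !big_ord_recr/=.
set A := \sum_(i < n) _ in IH *; set D := \sum_(i < n) _ in IH *.
have /andP[b0 bB1] := bB n.+1.
have W1 := Wge0 n.+1; have W2 := Wge0 n.+2; have W12 := WS n.+1; have e1 := e0 n.+1.
have y1 := normr_ge0 (y n.+1).
have w0 : 0 <= w n.+1 by apply: le_trans (xb n.+1).
(* Mass arriving from a neighbouring level counts at most with its absolute value, whereas in its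
   own level it carries the right sign up to e ([I3]): this asymmetry yields the contraction. *)
have I1 : y n.+1 * s n.+2 <= `|y n.+1|.
  by rewrite (le_trans (ler_norm _))// normrM ler_piMr.
have I2 : y n.+2 * s n.+1 <= `|y n.+2|.
  by rewrite (le_trans (ler_norm _))// normrM ler_piMr.
have I3 := ys n.+1.
set xi := x n.+1 - b n.+1 * y n.+1.
have xE : x n.+1 = b n.+1 * y n.+1 + xi by rewrite /xi; ring.
have I4 : xi * s n.+2 <= w n.+1.
  by rewrite (le_trans (ler_norm _))// normrM (le_trans _ (xb n.+1))// ler_piMr.
have I5 : - (xi * s n.+1) <= w n.+1.
  by rewrite (le_trans (ler_norm _))// normrN normrM (le_trans _ (xb n.+1))// ler_piMr.
rewrite xE.
have J1 : b n.+1 * W n.+2 * (y n.+1 * s n.+2) <= b n.+1 * W n.+2 * `|y n.+1|.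
  by rewrite ler_wpM2l// mulr_ge0.
have J2 : b n.+1 * W n.+1 * (`|y n.+1| - e n.+1) <= b n.+1 * W n.+1 * (y n.+1 * s n.+1).
  by rewrite ler_wpM2l// mulr_ge0.
have J3 : beta * W n.+1 * (`|y n.+1| - e n.+1) <= beta * W n.+1 * (y n.+1 * s n.+1).
  by rewrite ler_wpM2l// mulr_ge0.
have J4 : beta * W n.+1 * (y n.+2 * s n.+1) <= beta * W n.+1 * `|y n.+2|.
  by rewrite ler_wpM2l// mulr_ge0.
have J5 : W n.+2 * (xi * s n.+2) <= W n.+2 * w n.+1 by rewrite ler_wpM2l.
have J6 : W n.+1 * - (xi * s n.+1) <= W n.+1 * w n.+1 by rewrite ler_wpM2l.
have J7 : W n.+1 * w n.+1 <= W n.+2 * w n.+1 by rewrite ler_wpM2r.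
have J8 : b n.+1 * (W n.+1 * e n.+1) <= B * (W n.+1 * e n.+1).
  by rewrite ler_wpM2r// mulr_ge0.
clearbody xi A D; clear -IH J1 J2 J3 J4 J5 J6 J7 J8.
lra.
Qed.

End CompartmentDrift.

(* Up to level K the deviation from u is smoothed at the scale s^k / m, with
   m = sqrt N and s^(2k) the order of u k.  Beyond K, where u is below its own
   fluctuations, v is compared with 0 and no smoothing is needed as v >= 0: this
   keeps the curvature terms summable. *)
Section Level.
Context {R : realType}.
Variables (rho s m : R) (L K : nat).
Hypotheses (rho_gt0 : 0 < rho) (s_gt0 : 0 < s) (m_gt0 : 0 < m).
Local Notation u := (u_tilde rho L).

Definition target k : R := if (k <= K)%N then u k else 0.

Definition scale k : R := if (k <= K)%N then s ^+ k / m else 0.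

Definition level k v : R :=
  if (k <= K)%N then smooth_abs (s ^+ k / m) (v - u k) else v.

Definition slope k v : R :=
  if (k <= K)%N then (v - u k) / smooth_abs (s ^+ k / m) (v - u k) else 1.

Definition curvature k : R := if (k <= K)%N then (2 * (s ^+ k / m))^-1 else 0.

Let e_gt0 k : 0 < s ^+ k / m. Proof. by rewrite divr_gt0// exprn_gt0. Qed.

Lemma scale_ge0 k : 0 <= scale k.
Proof. by rewrite /scale; case: ifP => // _; exact: ltW. Qed.

Lemma target_ge0 k : 0 <= target k.
Proof. by rewrite /target; case: ifP => // _; rewrite ltW// u_tilde_gt0. Qed.

Lemma target_le k : target k <= u k.
Proof. by rewrite /target; case: ifP => // _; rewrite ltW// u_tilde_gt0. Qed.

Lemma level_ge k v : 0 <= v -> `|v - target k| <= level k v.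
Proof.
rewrite /target /level; case: ifP => _ v0; first exact: smooth_abs_ge.
by rewrite subr0 ger0_norm.
Qed.

Lemma level_le k v : 0 <= v -> level k v <= `|v - target k| + scale k.
Proof.
rewrite /target /level /scale; case: ifP => _ v0; first exact: smooth_abs_le (ltW _).
by rewrite subr0 ger0_norm// addr0.
Qed.

Lemma slope_le1 k v : `|slope k v| <= 1.
Proof.
by rewrite /slope; case: ifP => _; [exact: smooth_abs_slope_le1|rewrite normr1].
Qed.

Lemma slope_ge k v : 0 <= v -> `|v - target k| - scale k <= (v - target k) * slope k v.
Proof.
rewrite /target /slope /scale; case: ifP => _ v0; first exact: smooth_abs_slope_ge.
by rewrite !subr0 ger0_norm// mulr1.
Qed.

Lemma level_taylor k v h :
  level k (v + h) <= level k v + slope k v * h + h ^+ 2 * curvature k.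
Proof.
rewrite /level /slope /curvature; case: ifP => _.
  by rewrite addrAC; exact: smooth_abs_taylor.
by rewrite mul1r mulr0 addr0.
Qed.

Lemma level_lip k v h : `|level k (v + h) - level k v| <= `|h|.
Proof.
rewrite /level; case: ifP => _; first by rewrite addrAC; exact: smooth_abs_lip.
by rewrite addrAC subrr add0r.
Qed.

(** The contribution of one level to the drift of Phi^2, jumps of size 1/M occurring at rates M a
    upwards and M b downwards. The slope terms combine into a - b, whereas curvature and squared
    increments see a + b but carry a factor 1/M. *)
Lemma square_increment k v M Phi w a b : 0 < M -> 0 <= Phi -> 0 <= w -> 0 <= a -> 0 <= b ->
  forall up dn, up = w * (level k (v + M^-1) - level k v) ->
  dn = w * (level k (v - M^-1) - level k v) ->
  M * ((2 * Phi * up + up ^+ 2) * a + (2 * Phi * dn + dn ^+ 2) * b) <=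
  2 * Phi * (w * (slope k v * (a - b) + M^-1 * curvature k * (a + b)))
  + M^-1 * (w ^+ 2 * (a + b)).
Proof.
move=> M0 Phi0 w0 a0 b0 up dn upE dnE.
set h := M^-1; have h0 : 0 <= h by rewrite invr_ge0 ltW.
have Mh : M * h = 1 by rewrite divff// gt_eqF.
have U : M * up <= w * (slope k v + h * curvature k).
  rewrite upE mulrCA ler_wpM2l//.
  have -> : slope k v + h * curvature k = M * (slope k v * h + h ^+ 2 * curvature k).
    by transitivity (M * h * (slope k v + h * curvature k)); [rewrite Mh mul1r|ring].
  by rewrite ler_pM2l// lerBlDl addrA level_taylor.
have D : M * dn <= w * (- slope k v + h * curvature k).
  rewrite dnE mulrCA ler_wpM2l//.
  have -> : - slope k v + h * curvature k =
            M * (slope k v * (- h) + (- h) ^+ 2 * curvature k).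
    by transitivity (M * h * (- slope k v + h * curvature k)); [rewrite Mh mul1r|ring].
  by rewrite ler_pM2l// lerBlDl addrA level_taylor.
have sq h' : `|h'| = h -> M * (w * (level k (v + h') - level k v)) ^+ 2 <= h * w ^+ 2.
  move=> h'E; rewrite exprMn mulrCA [leRHS]mulrC ler_wpM2l ?sqr_ge0//.
  have -> : h = M * h ^+ 2 by rewrite expr2 mulrA Mh mul1r.
  rewrite ler_pM2l// -real_normK ?num_real// ler_pXn2r ?nnegrE//.
  by rewrite -h'E level_lip.
have U2 : M * up ^+ 2 <= h * w ^+ 2 by rewrite upE; apply: sq; rewrite ger0_norm.
have D2 : M * dn ^+ 2 <= h * w ^+ 2 by rewrite dnE; apply: sq; rewrite normrN ger0_norm.
have P0 : 0 <= 2 * Phi by rewrite mulr_ge0.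
have J1 := ler_wpM2r a0 (lerD (ler_wpM2l P0 U) U2).
have J2 := ler_wpM2r b0 (lerD (ler_wpM2l P0 D) D2).
clearbody h; clear -J1 J2; lra.
Qed.

End Level.

(** * Drift of the Lyapunov function at a fixed configuration *)

Section Drift.
Context {R : realType}.
Variables (alpha beta rho r s kappa gamma C Cu a Cd m : R) (L K n : nat).
Variables (W v p : nat -> R).
Local Notation u := (u_tilde rho L).
Hypotheses (beta_gt0 : 0 < beta) (rho_gt0 : 0 < rho) (rho_lt1 : rho < 1).
Hypotheses (alphaE : alpha = rho * beta) (L_gt0 : (0 < L)%N).
Hypotheses (gamma_gt0 : 0 < gamma) (C_gt0 : 0 < C) (W0 : W 0 = 0).
Hypothesis WS : forall k, W k <= W k.+1.
Hypothesis Wkappa : forall k, W k.+2 <= kappa * W k.+1.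
Hypothesis W_ge : forall k, r ^+ k <= C * W k.+1.
Hypothesis W_le : forall k, W k <= C * r ^+ k.
Hypothesis W_drift : forall k, rho * (1 + L.-1%:R * u k.+1) * (W k.+2 - W k.+1)
            - (W k.+1 - W k) <= - gamma * W k.+1.
Hypotheses (r_gt0 : 0 < r) (s_gt0 : 0 < s) (s_lt1 : s < 1) (rs_lt1 : r * s < 1).
Hypothesis Cu_ge0 : 0 <= Cu.
Hypothesis u_le : forall k, u k <= Cu * (s ^+ 2) ^+ k.
Hypotheses (a_gt0 : 0 < a) (a_ge : 2 * (alpha + beta) * kappa <= beta * gamma * a).
Hypotheses (Cd_ge0 : 0 <= Cd) (m_ge1 : 1 <= m).
Hypothesis m_ge : 8 * alpha * kappa * Cd <= beta * gamma * m ^+ 2.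
Hypotheses (K_gt0 : (0 < K)%N) (K_low : a / m <= s ^+ K) (K_high : s ^+ K.+1 <= a / m).
Hypothesis Kn : (K < n)%N.
Hypotheses (v0 : v 0 = 1) (v_ge0 : forall k, 0 <= v k) (v_le1 : forall k, v k <= 1).
Hypothesis vS : forall k, v k.+1 <= v k.
Hypotheses (p0 : p 0 = 1) (p_ge0 : forall k, 0 <= p k) (pS : forall k, p k.+1 <= p k).
Hypothesis p_le : forall k, p k <= v k ^+ L.
Hypothesis p_ge : forall k, v k ^+ L - p k <= Cd / m ^+ 2 * v k.

Local Notation c := (target rho L K).
Local Notation y := (fun k => v k - c k).
Let S := \sum_(k < n) W k.+1 * `|y k.+1|.
Let S1 := C * (1 - r * s)^-1.
Let m_gt0 : 0 < m. Proof. exact: lt_le_trans m_ge1. Qed.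
Let alpha_gt0 : 0 < alpha. Proof. by rewrite alphaE mulr_gt0. Qed.

Let W_ge0 k : 0 <= W k.
Proof. by elim: k => [|k IH]; [rewrite W0|apply: le_trans (WS k)]. Qed.

Let kappa_ge1 : 1 <= kappa.
Proof.
have W1 : 0 < W 1.
  by have := W_ge 0; rewrite expr0 => H; rewrite -(pmulr_rgt0 _ C_gt0) (lt_le_trans _ H).
by rewrite -(ler_pM2r W1) mul1r (le_trans (WS 1)).
Qed.

Let rs_gt0 : 0 < r * s. Proof. exact: mulr_gt0. Qed.

Let rs01 : 0 <= r * s < 1. Proof. by rewrite rs_lt1 ltW. Qed.

Let rsS k : (r * s) ^+ k.+1 <= (r * s) ^+ k.
Proof. by rewrite exprS ler_piMl ?exprn_ge0// ltW. Qed.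

Lemma sum_weight_scale : \sum_(k < n) W k.+1 * scale s m K k.+1 <= S1 / m.
Proof.
apply: (@le_trans _ _ (\sum_(k < n) (W k.+1 * s ^+ k.+1) / m)).
  apply: ler_sum => k _; rewrite /scale; case: ifP => _; first by rewrite mulrA.
  by rewrite mulr0 divr_ge0 ?mulr_ge0 ?exprn_ge0// ltW.
rewrite -mulr_suml ler_wpM2r ?invr_ge0 ?(ltW m_gt0)//.
apply: (sum_le_geometric _ rs01 (F := fun k => W k.+1 * s ^+ k.+1)) => [|k]; first exact: ltW.
apply: le_trans (ler_wpM2l (ltW C_gt0) (rsS k)).
by rewrite exprMn mulrA ler_wpM2r ?exprn_ge0// ltW.
Qed.

Lemma sum_weight_u : \sum_(k < n) W k.+1 * u k.+1 <= C * Cu * (1 - r * s)^-1.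
Proof.
apply: (sum_le_geometric _ rs01 (F := fun k => W k.+1 * u k.+1)); first by rewrite mulr_ge0// ltW.
move=> k; apply: le_trans (ler_wpM2l _ (rsS k)); last by rewrite mulr_ge0// ltW.
rewrite exprMn mulrACA ler_pM// ?(ltW (u_tilde_gt0 _ _ _))//.
rewrite (le_trans (u_le _))// ler_wpM2l// lerXn2r ?nnegrE ?sqr_ge0 ?(ltW s_gt0)//.
by rewrite expr2 ler_piMl// ltW.
Qed.

(** The curvature is of order m/s^k, and a profile near equilibrium jumps at level k at a rate of
    order u(k-1). The decay s^(2k) of u compensates the division by s^k and leaves the ratio r s. *)
Lemma sum_weight_u_scale :
  \sum_(k < n) W k.+1 / s ^+ k.+1 * u k <= C * Cu * (r / s) * (1 - r * s)^-1.
Proof.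
apply: (sum_le_geometric _ rs01 (F := fun k => W k.+1 / s ^+ k.+1 * u k)).
  by rewrite !mulr_ge0 ?invr_ge0// ltW.
move=> k.
have -> : C * Cu * (r / s) * (r * s) ^+ k =
    C * r ^+ k.+1 / s ^+ k.+1 * (Cu * (s ^+ 2) ^+ k).
  rewrite expr2 !exprMn !exprS; field.
  by rewrite expf_neq0 ?gt_eqF.
rewrite ler_pM// ?divr_ge0 ?exprn_ge0 ?(ltW s_gt0) ?(ltW rho_gt0)//.
by rewrite ler_wpM2r ?invr_ge0 ?exprn_ge0// ltW.
Qed.

(** Cost of truncating u at level K. Of the factor s^(2(K+1)) bounding u, one half compensates
    r^(K+1) and the other is at most a/m by [K_high]. *)
Lemma weight_cutoff : W K.+1 * u K.+1 <= C * Cu * (a / m).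
Proof.
apply: (@le_trans _ _ (C * Cu * s ^+ K.+1)); last first.
  by rewrite ler_wpM2l// mulr_ge0// ltW.
apply: (@le_trans _ _ (C * r ^+ K.+1 * (Cu * (s ^+ 2) ^+ K.+1))).
  by rewrite ler_pM// (ltW (u_tilde_gt0 _ _ _)).
have -> : C * r ^+ K.+1 * (Cu * (s ^+ 2) ^+ K.+1) = C * Cu * s ^+ K.+1 * (r * s) ^+ K.+1.
  by rewrite expr2 !exprMn; ring.
by rewrite ler_piMr ?exprn_ile1 ?(ltW rs_gt0) ?(ltW rs_lt1)// !mulr_ge0 ?exprn_ge0// ltW.
Qed.

Let u_le1 k : u k <= 1.
Proof.
by rewrite (le_trans (@u_tilde_le _ rho L k _ _))// ?exprn_ile1 ?(ltW rho_gt0) ?(ltW rho_lt1).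
Qed.

Let c_ge0 k : 0 <= c k. Proof. exact: target_ge0. Qed.

Let c_le1 k : c k <= 1.
Proof. by apply: le_trans (u_le1 k); exact: target_le. Qed.

(** The difference quotient of alpha z^L between c(k) and v(k), written as a sum so that it is
    nonnegative and makes sense when v(k) = c(k). *)
Let rate k := alpha * \sum_(i < L) v k ^+ (L.-1 - i) * c k ^+ i.

Let rateE k : rate k * y k = alpha * (v k ^+ L - c k ^+ L).
Proof. by rewrite subrXX /rate; ring. Qed.

Let rate_ge0 k : 0 <= rate k.
Proof.
by rewrite mulr_ge0 ?(ltW alpha_gt0)// sumr_ge0// => i _; rewrite mulr_ge0 ?exprn_ge0.
Qed.

(** The summand without c is at most 1; each of the L - 1 others contains a factor c(k) <= u(k). *)
Let rate_le k : rate k <= alpha * (1 + L.-1%:R * u k).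
Proof.
rewrite /rate ler_pM2l//.
move: (c_ge0 k) (c_le1 k) (target_le L K rho_gt0 k); move: (c k) (u k) => x z x0 x1 xz.
case: L L_gt0 => // l _.
rewrite big_ord_recl/= expr0 mulr1 subn0 lerD ?exprn_ile1//.
apply: (@le_trans _ _ (\sum_(i < l) z)).
  apply: ler_sum => i _; rewrite exprS.
  have H : x * x ^+ i <= z by rewrite (le_trans _ xz)// ler_piMr// exprn_ile1.
  by rewrite (le_trans _ H)// ler_piMl ?mulr_ge0 ?exprn_ge0// exprn_ile1.
by rewrite sumr_const card_ord -[leLHS]mulr_natl.
Qed.

Let rate_leL k : rate k <= alpha * L%:R.
Proof.
apply: (le_trans (rate_le k)); rewrite ler_pM2l//.
rewrite -[in leRHS](prednK L_gt0) -natr1 addrC lerD2r ler_piMr//.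
Qed.

(* Subtracting beta * c k.+1 makes the upward flow vanish at equilibrium, so that
   the truncation of u only contributes a defect at level K. *)
Let outflow k := alpha * p k - beta * c k.+1.

(** The first error is the sampling without replacement. In the second, alpha u(k)^L = beta u(k+1)
    cancels everything except at k = K, where c(k) is still u(k) but c(k+1) is already 0. *)
Let outflow_near k : `|outflow k - rate k * y k| <=
  alpha * (Cd / m ^+ 2) * v k + (k == K)%:R * (beta * u K.+1).
Proof.
rewrite rateE /outflow.
have -> : alpha * p k - beta * c k.+1 - alpha * (v k ^+ L - c k ^+ L) =
  - (alpha * (v k ^+ L - p k)) + (alpha * c k ^+ L - beta * c k.+1) by ring.
rewrite (le_trans (ler_normD _ _))// lerD//.
  rewrite normrN normrM (gtr0_norm alpha_gt0) -mulrA ler_pM2l// ger0_norm//.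
  by rewrite subr_ge0.
have E j : alpha * u j ^+ L = beta * u j.+1.
  by rewrite u_tildeS alphaE; ring.
rewrite /target; case: (ltngtP k K) => [kK|kK|->].
- by rewrite ?(ltnW kK) E subrr normr0 mul0r.
- by rewrite expr0n gtn_eqF// mulr0 mulr0 subrr normr0 mul0r.
- by rewrite mulr0 subr0 E mul1r ger0_norm// mulr_ge0 ?ltW// u_tilde_gt0.
Qed.

Let sum_delta : \sum_(k < n) W k.+2 * ((k.+1 == K)%:R * (beta * u K.+1))
  = W K.+1 * (beta * u K.+1).
Proof.
case: K K_gt0 Kn => // j _ jn.
rewrite (bigD1 (Ordinal (ltnW jn)))//= eqxx mul1r big1 ?addr0// => i.
by rewrite -val_eqE/= eqSS => /negbTE ->; rewrite mul0r mulr0.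
Qed.

Let S_ge0 : 0 <= S.
Proof. by apply: sumr_ge0 => k _; rewrite mulr_ge0. Qed.

Let v_le k : v k <= u k + `|y k|.
Proof.
have := target_le L K rho_gt0 k; have := ler_norm (y k); rewrite /=; lra.
Qed.

Let C2 := C * Cu * (1 - r * s)^-1.
Let C3 := C * Cu * (r / s) * (1 - r * s)^-1.

Let sum_weight_v : \sum_(k < n) W k.+1 * v k.+1 <= C2 + S.
Proof.
apply: le_trans (lerD sum_weight_u (lexx S)).
rewrite -big_split; apply: ler_sum => k _ /=.
by rewrite -mulrDr ler_wpM2l.
Qed.

(** In [compartment_drift], [W_drift] turns the main term into -beta gamma S. The other terms are,
    in order, the smoothing error, the sampling error (through v <= u + |y|), the truncation defect
    at level K and the flux lost at level n. *)
Lemma drift_first_order :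
  \sum_(k < n) W k.+1 * slope rho s m L K k.+1 (v k.+1) *
     (alpha * (p k - p k.+1) - beta * (v k.+1 - v k.+2)) <=
  - (beta * gamma) * S + (alpha * L%:R + beta) * (S1 / m)
  + 2 * (alpha * (Cd / m ^+ 2) * (kappa * (C2 + S)) + beta * (C * Cu * (a / m)))
  + beta * (W n * v n.+1).
Proof.
have -> : \sum_(k < n) W k.+1 * slope rho s m L K k.+1 (v k.+1) *
     (alpha * (p k - p k.+1) - beta * (v k.+1 - v k.+2)) =
  \sum_(k < n) W k.+1 * slope rho s m L K k.+1 (v k.+1) *
     ((outflow k - outflow k.+1) - beta * (y k.+1 - y k.+2)).
  by apply: eq_bigr => k _; rewrite /outflow; ring.
have c1 : c 1 = rho by rewrite /target K_gt0 u_tildeS u_tilde0 expr1n mulr1.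
have cn j : (K < j)%N -> c j = 0 by rewrite ltnNge /target => /negbTE ->.
apply: le_trans (@compartment_drift _ W (fun k => slope rho s m L K k (v k)) y outflow rate
  (fun k => alpha * (Cd / m ^+ 2) * v k + (k == K)%:R * (beta * u K.+1))
  (scale s m K) (alpha * L%:R) beta n W0 WS (ltW beta_gt0) _ _ _ _ _ _ _) _.
- by move=> k; exact: slope_le1.
- by move=> k; exact: slope_ge.
- exact: outflow_near.
- by move=> k; rewrite rate_ge0 rate_leL.
- by move=> k; exact: scale_ge0.
- by rewrite /outflow p0 c1 alphaE; ring.
(* Beyond K the target is 0 and the slope is 1, so the boundary flow is alpha p(n) >= 0; hence the
   requirement K < n. *)
- rewrite /outflow cn ?(leq_trans Kn)// mulr0 subr0 /slope leqNgt ltnS (ltnW Kn)/= mulr1.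
  by rewrite mulr_ge0// ltW.
rewrite lerD//; last first.
  by rewrite cn ?(leq_trans Kn)// subr0 ger0_norm.
rewrite !big_split/=; apply: lerD; first apply: lerD.
- rewrite mulr_sumr; apply: ler_sum => k _; rewrite mulrA ler_wpM2r//.
  have := W_drift k; have := rate_le k.+1; have := WS k.+1.
  move=> H1 H2 H3.
  have J1 : rate k.+1 * (W k.+2 - W k.+1) <=
     alpha * (1 + L.-1%:R * u k.+1) * (W k.+2 - W k.+1).
    by rewrite ler_wpM2r// subr_ge0.
  have J2 := ler_wpM2l (ltW beta_gt0) H3.
  rewrite alphaE in J1; lra.
- rewrite -mulr_sumr ler_wpM2l ?sum_weight_scale//.
  by rewrite addr_ge0// ?mulr_ge0 ?(ltW alpha_gt0)// ltW.
rewrite -mulr_sumr ler_pM2l//.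
under eq_bigr do rewrite mulrDr.
rewrite big_split/= sum_delta lerD//; last first.
  by rewrite mulrCA ler_pM2l// weight_cutoff.
have A0 : 0 <= alpha * (Cd / m ^+ 2).
  by rewrite mulr_ge0 ?divr_ge0 ?sqr_ge0// ltW.
apply: (@le_trans _ _ (alpha * (Cd / m ^+ 2) * (kappa * \sum_(k < n) W k.+1 * v k.+1))).
  rewrite !mulr_sumr; apply: ler_sum => k _; rewrite mulrCA ler_wpM2l// mulrA.
  by rewrite ler_wpM2r.
by rewrite ler_wpM2l// ler_wpM2l// (le_trans ler01).
Qed.

(** The term k = 0 vanishes because v(0) = c(0) = 1; for the others [kappa] pays for the shift of
    the weight. *)
Let sum_weight_shift : \sum_(k < n) W k.+1 * `|y k| <= kappa * S.
Proof.
have k0 : 0 <= kappa by rewrite (le_trans ler01).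
have -> : \sum_(k < n) W k.+1 * `|y k| = \sum_(0 <= k < n) W k.+1 * `|y k|.
  by rewrite big_mkord.
case: n Kn @S => // j _; rewrite big_nat_recl//.
rewrite v0 /target u_tilde0 subrr normr0 mulr0 add0r big_mkord mulr_sumr big_ord_recr/=.
rewrite -[leLHS]addr0 lerD ?mulr_ge0//; apply: ler_sum => i _.
by rewrite mulrA ler_wpM2r.
Qed.

(** Jumps at level k+1 have rates at most (alpha + beta) v(k), and v <= u + |y|. The u part is
    summed with the exact scale; the |y| part uses only the worst scale and is made small by the
    choice of [a]. *)
Lemma drift_second_order :
  \sum_(k < n) W k.+1 * (m ^- 2 * curvature s m K k.+1 *
     (alpha * (p k - p k.+1) + beta * (v k.+1 - v k.+2))) <=
  (alpha + beta) / 2 * (C3 / m + kappa * S / a).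
Proof.
have ab0 : 0 < alpha + beta by rewrite addr_gt0.
apply: (@le_trans _ _ (\sum_(k < n) (alpha + beta) / 2 *
    (W k.+1 / s ^+ k.+1 * u k / m + W k.+1 * `|y k| / a))); last first.
  rewrite -mulr_sumr ler_pM2l ?divr_gt0// big_split/= -!mulr_suml lerD//.
    by rewrite ler_wpM2r ?sum_weight_u_scale// invr_ge0 ltW.
  by rewrite ler_wpM2r ?sum_weight_shift// invr_ge0 ltW.
apply: ler_sum => k _.
have yk0 : 0 <= `|y k| := normr_ge0 _.
have R0 : 0 <= W k.+1 / s ^+ k.+1 * u k / m + W k.+1 * `|y k| / a.
  apply: addr_ge0; last by rewrite divr_ge0 ?mulr_ge0// ltW.
  rewrite divr_ge0 ?(ltW m_gt0)// mulr_ge0 ?(ltW (u_tilde_gt0 _ _ rho_gt0))//.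
  by rewrite divr_ge0// exprn_ge0// ltW.
rewrite /curvature; case: ifP => [kK|_]; last first.
  by rewrite mulr0 mul0r mulr0 mulr_ge0// ltW// divr_gt0.
have V : alpha * (p k - p k.+1) + beta * (v k.+1 - v k.+2) <= (alpha + beta) * v k.
  have pv : p k <= v k.
    apply: (le_trans (p_le k)); rewrite -[leRHS]expr1 ler_wiXn2l//.
  rewrite mulrDl lerD// ler_pM2l//.
    by rewrite (le_trans _ pv)// gerBl.
  by rewrite (le_trans _ (vS k))// gerBl.
have -> : (m ^- 2 * (2 * (s ^+ k.+1 / m))^-1) = 2^-1 * (s ^+ k.+1)^-1 / m.
  by field; rewrite expf_neq0 ?gt_eqF.
set z := (s ^+ k.+1)^-1.
have z0 : 0 < z by rewrite invr_gt0 exprn_gt0.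
(* Up to level K the smoothing scale s^k/m is at least a/m^2, that is [a] jumps of size 1/N: this is
   the purpose of [K_low]. *)
have zm : z / m <= a^-1.
  rewrite /z -invfM lef_pV2 ?posrE ?mulr_gt0 ?exprn_gt0// -ler_pdivrMr//.
  by rewrite (le_trans K_low)// ler_wiXn2l ?(ltW s_gt0) ?(ltW s_lt1).
apply: (@le_trans _ _ (W k.+1 * (2^-1 * z / m * ((alpha + beta) * (u k + `|y k|))))).
  rewrite ler_wpM2l// ler_wpM2l//; first by rewrite divr_ge0 ?(ltW m_gt0)// mulr_ge0 ?(ltW z0).
  by rewrite (le_trans V)// ler_pM2l.
have -> : W k.+1 * (2^-1 * z / m * ((alpha + beta) * (u k + `|y k|))) =
  (alpha + beta) / 2 * (W k.+1 * z * u k / m + W k.+1 * `|y k| * (z / m)) by ring.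
by rewrite ler_wpM2l// ?divr_ge0// ?(ltW ab0)// lerD2l ler_wpM2l// mulr_ge0.
Qed.

Lemma drift_le :
  \sum_(k < n) W k.+1 * slope rho s m L K k.+1 (v k.+1) *
     (alpha * (p k - p k.+1) - beta * (v k.+1 - v k.+2)) +
  \sum_(k < n) W k.+1 * (m ^- 2 * curvature s m K k.+1 *
     (alpha * (p k - p k.+1) + beta * (v k.+1 - v k.+2))) <=
  - (beta * gamma / 2) * \sum_(k < n) W k.+1 * level rho s m L K k.+1 (v k.+1)
  + ((alpha * L%:R + beta + beta * gamma / 2) * S1 + 2 * alpha * Cd * kappa * C2
     + 2 * beta * C * Cu * a + (alpha + beta) / 2 * C3) / m
  + beta * (W n * v n.+1).
Proof.
have bg : 0 < beta * gamma by rewrite mulr_gt0.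
have H1 := drift_first_order; have H2 := drift_second_order.
have H3 : \sum_(k < n) W k.+1 * level rho s m L K k.+1 (v k.+1) <= S + S1 / m.
  apply: le_trans (lerD (lexx S) sum_weight_scale).
  rewrite -big_split; apply: ler_sum => k _ /=; rewrite -mulrDr ler_wpM2l//.
  exact: level_le.
have H4 : alpha * (Cd / m ^+ 2) * (kappa * C2) <= alpha * Cd * kappa * C2 / m.
  have -> : alpha * (Cd / m ^+ 2) * (kappa * C2) = alpha * Cd * kappa * C2 / m * m^-1.
    by field; rewrite gt_eqF.
  rewrite ler_piMr ?invf_le1// !mulr_ge0 ?invr_ge0 ?subr_ge0 ?(ltW m_gt0)
    ?(ltW alpha_gt0) ?(ltW C_gt0) ?(ltW rs_lt1)//.
  by rewrite (le_trans ler01).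
(* Sampling (through [m_ge]) and curvature (through [a_ge]) each consume a quarter of the
   contraction rate beta gamma; half of it remains. *)
have H5 : 2 * (alpha * (Cd / m ^+ 2) * (kappa * S)) <= beta * gamma / 4 * S.
  have -> : 2 * (alpha * (Cd / m ^+ 2) * (kappa * S)) = 2 * alpha * kappa * Cd / m ^+ 2 * S by ring.
  by rewrite ler_wpM2r// ler_pdivrMr ?exprn_gt0//;
    move: m_ge; move: (beta * gamma) (m ^+ 2) => x1 x2; lra.
have H6 : (alpha + beta) / 2 * (kappa * S / a) <= beta * gamma / 4 * S.
  have -> : (alpha + beta) / 2 * (kappa * S / a) = (alpha + beta) * kappa / 2 / a * S by ring.
  by rewrite ler_wpM2r// ler_pdivrMr//;
    move: a_ge; move: (beta * gamma) (alpha + beta) => x1 x2; lra.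
have H7 := ler_wpM2l (ltW bg) H3.
set X := \sum_(k < n) _ in H1 *; set Y := \sum_(k < n) _ in H2 *.
set Z := \sum_(k < n) _ in H7 *.
rewrite !mulrDr in H1 H2 H7.
move: H1 H2 H4 H5 H6 H7; move: X Y Z S S1 C2 C3 (W n * v n.+1) => X Y Z x1 x2 x3 x4 x5.
move=> *; lra.
Qed.

End Drift.

(** * Stationary moments *)

Section TestFunctions.
Context {R : realType}.
Variables (alpha beta : R) (L N : nat).
Hypotheses (L_gt0 : (0 < L)%N) (LN : (L <= N)%N).

Let N_gt0 : (0 < N)%N. Proof. exact: leq_trans LN. Qed.

(** At most one indicator is nonzero, so there are no cross terms. *)
Lemma sqr_sum_indicator n (g : nat -> R) (j : nat) :
  (\sum_(k < n) g k * (j == k)%:R) ^+ 2 = \sum_(k < n) g k ^+ 2 * (j == k)%:R.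
Proof.
have E (h : nat -> R) : \sum_(k < n) h k * (j == k)%:R = (j < n)%N%:R * h j.
  case: (ltnP j n) => jn.
    rewrite (bigD1 (Ordinal jn))//= eqxx mulr1 mul1r big1 ?addr0// => i.
    by rewrite -val_eqE/= eq_sym => /negbTE ->; rewrite mulr0.
  rewrite mul0r big1// => i _; rewrite gtn_eqF ?mulr0//.
  exact: leq_trans (ltn_ord i) jn.
rewrite E (E (fun k => g k ^+ 2)) exprMn; congr (_ * _).
by case: (_ < _)%N; rewrite ?expr1n ?expr0n.
Qed.

Lemma generator_sqr_sum (psi : nat -> R -> R) n (x : config N) :
  let Phi z := \sum_(k < n) psi k (tail z k.+1) in
  let up k := psi k (tail x k.+1 + N%:R^-1) - psi k (tail x k.+1) in
  let dn k := psi k (tail x k.+1 - N%:R^-1) - psi k (tail x k.+1) in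
  generator alpha beta L (fun z => Phi z ^+ 2) x =
  \sum_(k < n) N%:R *
    ((2 * Phi x * up k + up k ^+ 2) * (alpha * (sample_tail L x k - sample_tail L x k.+1)) +
     (2 * Phi x * dn k + dn k ^+ 2) * (beta * (tail x k.+1 - tail x k.+2))).
Proof.
move=> Phi up dn.
have sqE z (g : nat -> R) (j : nat) : Phi z = Phi x + \sum_(k < n) g k * (j == k :> nat)%:R ->
    Phi z ^+ 2 - Phi x ^+ 2 =
    \sum_(k < n) (2 * Phi x * g k + g k ^+ 2) * (j == k :> nat)%:R.
  move=> ->; under [RHS]eq_bigr do rewrite mulrDl -mulrA.
  by rewrite big_split/= -mulr_sumr -sqr_sum_indicator; ring.
apply: (@generator_level_sum _ alpha beta L N _ x n
  (fun k => 2 * Phi x * up k + up k ^+ 2) (fun k => 2 * Phi x * dn k + dn k ^+ 2)) => //.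
- move=> i; apply: (sqE _ up); rewrite /Phi -big_split; apply: eq_bigr => k _ /=.
  rewrite tail_add// /up; case: (_ == _); rewrite ?mulr1 ?mulr0 ?mul1r ?mul0r ?addr0//.
  by rewrite addrCA subrr addr0.
- move=> i xi; have E k : (x i == k.+1) = ((x i).-1 == k) by case: (x i) xi.
  under eq_bigr do rewrite E.
  apply: (sqE _ dn); rewrite /Phi -big_split; apply: eq_bigr => k _ /=.
  rewrite tail_remove// E /dn.
  case: (_ == _); rewrite ?mulr1 ?mulr0 ?mul1r ?mul0r ?subr0 ?addr0//.
  by rewrite addrCA subrr addr0.
Qed.

(** The transitions between intermediate levels telescope; only the flows across the two ends
    remain. *)
Lemma generator_sum_tail m n (x : config N) : (m <= n)%N ->
  generator alpha beta L (fun z => \sum_(k < n) (m <= k)%N%:R * tail z k.+1) x =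
  alpha * (sample_tail L x m - sample_tail L x n) - beta * (tail x m.+1 - tail x n.+1).
Proof.
move=> mn.
have NR : N%:R != 0 :> R by rewrite pnatr_eq0 -lt0n.
rewrite (@generator_level_sum _ alpha beta L N _ x n
  (fun k => (m <= k)%N%:R / N%:R) (fun k => - ((m <= k)%N%:R / N%:R)))//.
- rewrite -(subnKC mn); elim: (n - m)%N => [|j IH].
    rewrite addn0 !subrr !mulr0 subrr big1// => i _.
    by rewrite leqNgt ltn_ord !mul0r oppr0 mul0r addr0 mulr0.
  by rewrite addnS big_ord_recr/= IH leq_addr/=; field.
- move=> i; rewrite -sumrB; apply: eq_bigr => k _.
  by rewrite tail_add//; ring.
- move=> i xi; rewrite -sumrB; apply: eq_bigr => k _.
  by rewrite tail_remove//; ring.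
Qed.

End TestFunctions.

Section StationaryMoments.
Context {R : realType} {d : measure_display} {Omega : measurableType d}.
Variables (alpha beta : R) (L N : nat) (P : probability Omega R).
Variable X : R -> Omega -> config N.
Hypotheses (alpha_gt0 : 0 < alpha) (beta_gt0 : 0 < beta) (L_gt0 : (0 < L)%N).
Hypothesis LN : (L.*2 <= N)%N.
Hypothesis Xqueue : queue_length_process alpha beta L P X.
Hypothesis Xinv : starts_from_invariant_law P X.
Local Notation E := (mean P (X 0)).
Local Notation rho := (alpha / beta).
Hypothesis rho_le1 : rho <= 1.

Let mX := measurable_initial Xqueue.
Let N_gt0 : (0 < N)%N. Proof. by rewrite (leq_trans _ LN)// double_gt0. Qed.
Let LN' : (L <= N)%N. Proof. by rewrite (leq_trans _ LN)// -addnn leq_addr. Qed.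

Lemma bdd_unit (f : config N -> R) : (forall x, 0 <= f x <= 1) -> bdd f.
Proof. by move=> f01; exists 1 => x; case/andP: (f01 x) => f0 f1; rewrite ger0_norm. Qed.

Lemma bdd_tail k : bdd (fun x : config N => tail x k : R).
Proof. by apply: bdd_unit => x; rewrite tail_ge0 tail_le1. Qed.

Lemma sample_tail_le (x : config N) k : sample_tail L x k <= (tail x k : R) ^+ L :> R.
Proof. by have /andP[H _] := @sample_tail_bounds R L N x k L_gt0 LN; rewrite -subr_ge0. Qed.

Lemma sample_tail_le1 (x : config N) k : sample_tail L x k <= 1 :> R.
Proof. by rewrite (le_trans (sample_tail_le x k))// exprn_ile1 ?tail_ge0 ?tail_le1. Qed.

Lemma bdd_sample_tail k : bdd (fun x : config N => sample_tail L x k : R).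
Proof. by apply: bdd_unit => x; rewrite sample_tail_ge0 sample_tail_le1. Qed.

Lemma mean_tail_cvg0 : E (fun x => tail x n) @[n --> \oo] --> (0 : R).
Proof.
apply: (@mean_cvg0 _ _ _ P N (X 0) mX (fun n x => tail x n) 1).
  by move=> k x; rewrite ger0_norm ?tail_ge0// tail_le1.
move=> x; apply: cvg_near_cst; near=> n.
rewrite /tail (_ : [set i | _]%SET = finset.set0) ?cards0 ?mul0r//.
apply/setP => i; rewrite !finset.inE; apply/negbTE; rewrite -ltnNge.
apply: (@leq_ltn_trans (\max_(i < N) x i)); first exact: leq_bigmax.
by near: n; exact: nbhs_infty_gt.
Unshelve. all: by end_near. Qed.

(* Flow balance between levels k and k.+1: the test function is the number of
   customers in positions k.+1 to n, divided by N. *)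
Lemma mean_tailS_le k : E (fun x => tail x k.+1) <= rho * E (fun x => sample_tail L x k).
Proof.
have H n : (k <= n)%N -> beta * E (fun x => tail x k.+1) <=
    alpha * E (fun x => sample_tail L x k) + beta * E (fun x => tail x n.+1).
  move=> kn.
  pose F (v : nat -> R) := \sum_(j < n) (k <= j)%N%:R * v j.+1.
  have bF : bdd (fun x : config N => F (tail x)).
    apply: (bdd_sum n (F := fun j x => (k <= j)%N%:R * tail x j.+1)) => j.
    by apply: bddM; [exact: bdd_cst|exact: bdd_tail].
  have b1 : bdd (fun x : config N => alpha * sample_tail L x k).
    by apply: bddM; [exact: bdd_cst|exact: bdd_sample_tail].
  have b2 j : bdd (fun x : config N => beta * tail x j).
    by apply: bddM; [exact: bdd_cst|exact: bdd_tail].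
  have b3 : bdd (fun x : config N => alpha * sample_tail L x k + beta * tail x n.+1).
    exact: bddD.
  have := mean_generator (ltW alpha_gt0) (ltW beta_gt0) L_gt0 LN' Xqueue Xinv bF.
  set G := generator _ _ _ _.
  have bG : bdd G.
    exact: bdd_generator (ltW alpha_gt0) (ltW beta_gt0) L_gt0 LN' _ bF.
  have le1 : E (fun x => beta * tail x k.+1 + G x) <=
             E (fun x => alpha * sample_tail L x k + beta * tail x n.+1).
    apply: (le_mean _ mX); [exact: bddD|exact: b3|].
    move=> x; rewrite /G /F generator_sum_tail//.
    have : 0 <= alpha * sample_tail L x n by rewrite mulr_ge0 ?(ltW alpha_gt0) ?sample_tail_ge0.
    by lra.
  move=> G0; move: le1; rewrite (meanD _ mX)// G0 addr0 (meanD _ mX)//.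
  by rewrite !(meanZ _ mX)//; [exact: bdd_tail|exact: bdd_sample_tail|exact: bdd_tail].
rewrite mulrAC ler_pdivlMr// mulrC.
have c : alpha * E (fun x => sample_tail L x k) + beta * E (fun x => tail x n.+1) @[n --> \oo]
    --> alpha * E (fun x => sample_tail L x k) + beta * (0 : R).
  apply: cvgD; first exact: cvg_cst.
  apply: cvgM; first exact: cvg_cst.
  by rewrite (cvg_shiftS (fun n => E (fun x => tail x n))); exact: mean_tail_cvg0.
rewrite mulr0 addr0 in c; apply: (cvgr_to_ge c); near=> n; apply: H.
by near: n; exact: nbhs_infty_ge.
Unshelve. all: by end_near. Qed.

Lemma mean_tail_le k : E (fun x => tail x k) <= rho ^+ k.
Proof.
elim: k => [|k IH].
  rewrite expr0 -[leRHS](mean_cst P (X 0)); apply: (le_mean _ mX).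
  - exact: bdd_tail.
  - exact: bdd_cst.
  - by move=> x; exact: tail_le1.
apply: (le_trans (mean_tailS_le k)); rewrite exprS ler_wpM2l ?divr_ge0
  ?(ltW alpha_gt0) ?(ltW beta_gt0)//.
apply: le_trans IH; apply: (le_mean _ mX); [exact: bdd_sample_tail|exact: bdd_tail|].
move=> x; rewrite (le_trans (sample_tail_le x k))// -[leRHS]expr1.
by rewrite ler_wiXn2l ?tail_ge0 ?tail_le1.
Qed.

Lemma mean_tailS_le_sqr k : (1 < L)%N ->
  E (fun x => tail x k.+1) <= E (fun x => tail x k ^+ 2).
Proof.
move=> L1; apply: (le_trans (mean_tailS_le k)).
apply: (@le_trans _ _ (E (fun x => sample_tail L x k))).
  by rewrite ler_piMl// mean_ge0// => x; exact: sample_tail_ge0.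
apply: (le_mean _ mX); first exact: bdd_sample_tail.
  by apply: bddM; exact: bdd_tail.
move=> x; rewrite (le_trans (sample_tail_le x k))//.
by rewrite ler_wiXn2l ?tail_ge0 ?tail_le1.
Qed.

End StationaryMoments.

(** The bound D on the terms first gives convergence of the series, with a poor constant; then d(n)
    tends to 0 and the boundary term B d(n) disappears in the limit. *)
Lemma partial_sums_le (R : realType) (d : nat -> R) A B D K :
  (forall k, 0 <= d k) -> 0 <= B ->
  (forall n, (K < n)%N -> \sum_(k < n) d k <= A + B * d n) ->
  (forall n, (K < n)%N -> d n <= D) -> forall j, \sum_(k < j) d k <= A.
Proof.
move=> d0 B0 dAB dD j.
have mono i n : (i <= n)%N -> \sum_(k < i) d k <= \sum_(k < n) d k.
  move=> /subnKC <-; elim: (n - i)%N => [|l IH]; first by rewrite addn0.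
  by rewrite addnS big_ord_recr/= (le_trans IH)// lerDl.
have cd : cvgn (series d).
  apply: nondecreasing_is_cvgn.
    by move=> i n lin; rewrite /series/= !big_mkord mono.
  exists (A + B * D) => _ [n _ <-]; rewrite /series/= big_mkord.
  apply: (le_trans (mono _ _ (leq_addl K.+1 n))).
  have Kn : (K < K.+1 + n)%N by rewrite addSn ltnS leq_addr.
  by rewrite (le_trans (dAB _ Kn))// lerD2l ler_wpM2l// dD.
have d_cvg0 := cvg_series_cvg_0 cd.
have c : A + B * d n @[n --> \oo] --> A + B * 0.
  by apply: cvgD; [exact: cvg_cst|apply: cvgM => //; exact: cvg_cst].
rewrite mulr0 addr0 in c; apply: (cvgr_to_ge c); near=> n.
have Kn : (K < n)%N by near: n; exact: nbhs_infty_gt.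
apply: le_trans (dAB n Kn); apply: mono.
by near: n; exact: nbhs_infty_ge.
Unshelve. all: by end_near. Qed.

(** * Second moments of the deviation under the invariant law *)

Section SecondMoment.
Context {R : realType} {d : measure_display} {Omega : measurableType d}.
Variables (alpha beta r s kappa gamma C Cu a : R) (L N K : nat) (P : probability Omega R).
Variables (X : R -> Omega -> config N) (W : nat -> R).
Hypotheses (alpha_gt0 : 0 < alpha) (beta_gt0 : 0 < beta) (L_gt0 : (0 < L)%N).
Hypothesis LN : (L.*2 <= N)%N.
Hypothesis Xqueue : queue_length_process alpha beta L P X.
Hypothesis Xinv : starts_from_invariant_law P X.
Local Notation E := (mean P (X 0)).
Local Notation rho := (alpha / beta).
Local Notation u := (u_tilde rho L).
Local Notation m := (Num.sqrt (N%:R : R)).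
Hypothesis rho_lt1 : rho < 1.
Hypotheses (gamma_gt0 : 0 < gamma) (C_gt0 : 0 < C) (W0 : W 0 = 0).
Hypothesis WS : forall k, W k <= W k.+1.
Hypothesis Wkappa : forall k, W k.+2 <= kappa * W k.+1.
Hypothesis W_ge : forall k, r ^+ k <= C * W k.+1.
Hypothesis W_le : forall k, W k <= C * r ^+ k.
Hypothesis W_drift : forall k, rho * (1 + L.-1%:R * u k.+1) * (W k.+2 - W k.+1)
            - (W k.+1 - W k) <= - gamma * W k.+1.
Hypotheses (r_gt0 : 0 < r) (s_gt0 : 0 < s) (s_lt1 : s < 1) (rs_lt1 : r * s < 1).
Hypothesis r2rho : r ^+ 2 * rho <= 1.
Hypothesis Cu_ge0 : 0 <= Cu.
Hypothesis u_le : forall k, u k <= Cu * (s ^+ 2) ^+ k.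
Hypotheses (a_gt0 : 0 < a) (a_ge : 2 * (alpha + beta) * kappa <= beta * gamma * a).
Local Notation Cd := ((L * L.*2)%:R : R).
Hypothesis N_ge : 8 * alpha * kappa * Cd <= beta * gamma * N%:R.
Hypotheses (K_gt0 : (0 < K)%N) (K_low : a / m <= s ^+ K) (K_high : s ^+ K.+1 <= a / m).

Let mX := measurable_initial Xqueue.
Let N_gt0 : (0 < N)%N. Proof. by rewrite (leq_trans _ LN)// double_gt0. Qed.
Let LN' : (L <= N)%N. Proof. by rewrite (leq_trans _ LN)// -addnn leq_addr. Qed.
Let rho_gt0 : 0 < rho. Proof. exact: divr_gt0. Qed.
Let m2 : m ^+ 2 = N%:R. Proof. by rewrite sqr_sqrtr. Qed.
Let m_ge1 : 1 <= m.
Proof. by rewrite -[leLHS]sqrtr1 ler_wsqrtr// ler1n. Qed.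
Let m_gt0 : 0 < m. Proof. exact: lt_le_trans m_ge1. Qed.
Let W_ge0 k : 0 <= W k.
Proof. by elim: k => [|k IH]; [rewrite W0|apply: le_trans (WS k)]. Qed.

Local Notation c := (target rho L K).
Local Notation phi := (level rho s m L K).

Let Phi n (x : config N) := \sum_(k < n) W k.+1 * phi k.+1 (tail x k.+1).
Let dev k := W k.+1 ^+ 2 * E (fun x : config N => (tail x k.+1 - c k.+1) ^+ 2).

Let bdd_dev k : bdd (fun x : config N => (tail x k - c k) ^+ 2).
Proof.
have b : bdd (fun x : config N => tail x k - c k).
  by apply: bddD; [exact: bdd_tail|exact: bdd_cst].
by apply: bddM.
Qed.

Let bdd_Phi n : bdd (Phi n).
Proof.
apply: (bdd_sum n (F := fun k x => W k.+1 * phi k.+1 (tail x k.+1))) => k.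
apply: bddM; first exact: bdd_cst.
exists (1 + `|c k.+1| + scale s m K k.+1) => x.
have v0 : 0 <= tail x k.+1 :> R := tail_ge0 x k.+1.
have le1 : phi k.+1 (tail x k.+1) <= `|tail x k.+1 - c k.+1| + scale s m K k.+1.
  exact: level_le.
have ge1 : `|tail x k.+1 - c k.+1| <= phi k.+1 (tail x k.+1) by exact: level_ge.
rewrite ger0_norm ?(le_trans _ ge1)// (le_trans le1)// lerD2r.
rewrite (le_trans (ler_normB _ _))// lerD2r ger0_norm//.
exact: tail_le1.
Qed.

Let bdd_Phi2 n : bdd (fun x => Phi n x ^+ 2).
Proof. by apply: bddM; exact: bdd_Phi. Qed.

Let Phi_ge0 n x : 0 <= Phi n x.
Proof.
apply: sumr_ge0 => k _; rewrite mulr_ge0//.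
exact: le_trans (normr_ge0 _) (level_ge _ _ _ _ _ _ (tail_ge0 x k.+1)).
Qed.

Let Q := ((alpha * L%:R + beta + beta * gamma / 2) * (C * (1 - r * s)^-1)
     + 2 * alpha * Cd * kappa * (C * Cu * (1 - r * s)^-1)
     + 2 * beta * C * Cu * a
     + (alpha + beta) / 2 * (C * Cu * (r / s) * (1 - r * s)^-1)).
Let g := beta * gamma / 2.

Let generator_Phi2 n x : (K < n)%N ->
  generator alpha beta L (fun z => Phi n z ^+ 2) x <=
  - g * Phi n x ^+ 2 + (2 / g) * (Q ^+ 2 / N%:R)
  + (2 / g) * (beta ^+ 2 * W n ^+ 2 * tail x n.+1 ^+ 2)
  + (alpha + beta) / N%:R * \sum_(k < n) W k.+1 ^+ 2 * tail x k.
Proof.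
move=> Kn.
have NR : 0 < N%:R :> R by rewrite ltr0n.
pose A k := alpha * (sample_tail L x k - sample_tail L x k.+1).
pose B k := beta * (tail x k.+1 - tail x k.+2).
have A0 k : 0 <= A k by rewrite mulr_ge0 ?(ltW alpha_gt0)// subr_ge0 sample_tailS.
have B0 k : 0 <= B k by rewrite mulr_ge0 ?(ltW beta_gt0)// subr_ge0 tailS.
rewrite (generator_sqr_sum alpha beta L_gt0 LN' (fun k v => W k.+1 * phi k.+1 v) n x).
rewrite -/(Phi n x).
have D := @drift_le R alpha beta rho r s kappa gamma C Cu a Cd m L K n W
  (tail x) (sample_tail L x) beta_gt0 rho_gt0 rho_lt1.
have {D} D : \sum_(k < n) W k.+1 * slope rho s m L K k.+1 (tail x k.+1) * (A k - B k) +
    \sum_(k < n) W k.+1 * (m ^- 2 * curvature s m K k.+1 * (A k + B k)) <=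
    - g * Phi n x + Q / m + beta * (W n * tail x n.+1).
  apply: D => //.
  - by rewrite divfK// gt_eqF.
  - by rewrite m2.
  - exact: tail0.
  - by move=> k; exact: tail_ge0.
  - by move=> k; exact: tail_le1.
  - by move=> k; exact: tailS.
  - exact: sample_tail0.
  - by move=> k; exact: sample_tail_ge0.
  - by move=> k; exact: sample_tail_le.
  - by move=> k; rewrite m2; have /andP[] := @sample_tail_bounds R L N x k L_gt0 LN.
apply: (@le_trans _ _ (\sum_(k < n)
  (2 * Phi n x * (W k.+1 * (slope rho s m L K k.+1 (tail x k.+1) * (A k - B k)
       + N%:R^-1 * curvature s m K k.+1 * (A k + B k)))
   + N%:R^-1 * (W k.+1 ^+ 2 * (A k + B k))))).
  apply: ler_sum => k _.
  apply: (@square_increment _ rho s m L K s_gt0 m_gt0 k.+1 (tail x k.+1) N%:R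
     (Phi n x) (W k.+1) (A k) (B k)) => //; by rewrite mulrBr.
rewrite big_split/= -!mulr_sumr.
have T3 : \sum_(k < n) W k.+1 ^+ 2 * (A k + B k) <=
    (alpha + beta) * \sum_(k < n) W k.+1 ^+ 2 * tail x k.
  rewrite mulr_sumr; apply: ler_sum => k _; rewrite mulrCA ler_wpM2l ?sqr_ge0//.
  have pv : sample_tail L x k <= tail x k :> R.
    rewrite (le_trans (sample_tail_le L_gt0 LN x k))// -[leRHS]expr1.
    by rewrite ler_wiXn2l ?tail_ge0 ?tail_le1.
  rewrite mulrDl lerD// ler_pM2l//.
    by rewrite (le_trans _ pv)// gerBl sample_tail_ge0.
  by rewrite (le_trans _ (tailS x k))// gerBl tail_ge0.
have T12 : \sum_(k < n) W k.+1 * (slope rho s m L K k.+1 (tail x k.+1) * (A k - B k)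
       + N%:R^-1 * curvature s m K k.+1 * (A k + B k)) <=
    - g * Phi n x + Q / m + beta * (W n * tail x n.+1).
  apply: le_trans D; rewrite -big_split; apply: ler_sum => k _ /=.
  by rewrite m2 mulrDr mulrA.
have g0 : 0 < g by rewrite divr_gt0// mulr_gt0.
have I1 := ler_wpM2l (mulr_ge0 (ler0n R 2) (Phi_ge0 n x)) T12.
have I2 : N%:R^-1 * \sum_(k < n) W k.+1 ^+ 2 * (A k + B k) <=
    (alpha + beta) / N%:R * \sum_(k < n) W k.+1 ^+ 2 * tail x k.
  by rewrite mulrAC ler_pdivlMr// mulrAC mulVf ?mul1r// gt_eqF.
(* The drift supplies -2 g Phi^2; the two remainders linear in Phi, from Q/m and from the flux at
   level n, each take g/2, which leaves -g. *)
have AM z : 2 * Phi n x * z <= g / 2 * Phi n x ^+ 2 + 2 / g * z ^+ 2.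
  have -> : 2 * Phi n x * z = g / 2 * Phi n x ^+ 2 + 2 / g * z ^+ 2
      - g / 2 * (Phi n x - 2 / g * z) ^+ 2 by field; rewrite gt_eqF.
  by rewrite gerBl mulr_ge0 ?sqr_ge0// divr_ge0// ltW.
have AM1 := AM (Q / m); have AM2 := AM (beta * (W n * tail x n.+1)).
rewrite expr_div_n m2 in AM1; rewrite (_ : (beta * (W n * tail x n.+1)) ^+ 2 =
  beta ^+ 2 * W n ^+ 2 * tail x n.+1 ^+ 2) in AM2; last by ring.
rewrite !mulrDr in I1.
move: I1 I2 AM1 AM2.
move: (\sum_(k < n) W k.+1 * _) (N%:R^-1 * \sum_(k < n) _) (_ / _ * \sum_(k < n) _) => x1 x2 x3.
move: (Q / m) (Q ^+ 2 / _) => x4 x5.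
move=> *; lra.
Qed.

Let bdd_tail2 k : bdd (fun x : config N => (tail x k : R) ^+ 2).
Proof. by apply: bddM; exact: bdd_tail. Qed.

Let mean_dev_ge0 k : 0 <= E (fun x => (tail x k - c k) ^+ 2).
Proof. by apply: mean_ge0 => x; exact: sqr_ge0. Qed.

Let dev_ge0 k : 0 <= dev k.
Proof. by rewrite mulr_ge0 ?sqr_ge0. Qed.

(** Passage from l^1 to l^2: the terms of Phi are nonnegative and dominate W |v - c|, and the square
    of their sum is at least the sum of their squares. *)
Let sum_dev_le n : \sum_(k < n) dev k <= E (fun x => Phi n x ^+ 2).
Proof.
have bW k : bdd (fun x : config N => W k.+1 ^+ 2 * (tail x k.+1 - c k.+1) ^+ 2).
  by apply: bddM; [exact: bdd_cst|exact: bdd_dev].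
have -> : \sum_(k < n) dev k =
    E (fun x => \sum_(k < n) W k.+1 ^+ 2 * (tail x k.+1 - c k.+1) ^+ 2).
  rewrite (mean_sum _ mX n (F := fun k x => W k.+1 ^+ 2 * (tail x k.+1 - c k.+1) ^+ 2))//.
  by apply: eq_bigr => k _; rewrite (meanZ _ mX).
apply: (le_mean _ mX) => //.
  exact: (bdd_sum n (F := fun k x => W k.+1 ^+ 2 * (tail x k.+1 - c k.+1) ^+ 2)).
move=> x; rewrite /Phi; elim: n => [|n IH]; first by rewrite !big_ord0 expr0n.
rewrite !big_ord_recr/= [leRHS]sqrrD -exprMn.
have P0 := Phi_ge0 n x.
have v0 : 0 <= tail x n.+1 :> R := tail_ge0 x n.+1.
have ge1 : `|tail x n.+1 - c n.+1| <= phi n.+1 (tail x n.+1) by exact: level_ge.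
have phi0 : 0 <= phi n.+1 (tail x n.+1) by exact: le_trans ge1.
rewrite lerD//.
  by apply: (le_trans IH); rewrite lerDl mulrn_wge0// mulr_ge0// mulr_ge0.
rewrite !exprMn ler_wpM2l ?sqr_ge0// -real_normK ?num_real//.
by rewrite lerXn2r ?nnegrE.
Qed.

Let dev_tail n : (K <= n)%N -> dev n = W n.+1 ^+ 2 * E (fun x => tail x n.+1 ^+ 2).
Proof.
move=> Kn; rewrite /dev; congr (_ * mean P _ _); apply/funext => x.
by rewrite /target leqNgt ltnS Kn subr0.
Qed.

(** E(v^2) <= E(v) <= rho^(n+1) compensates the weight r^(2(n+1)). For theta = rho this gives
    boundedness only, not decay, which is all that [partial_sums_le] asks. *)
Let dev_le n : (K <= n)%N -> dev n <= C ^+ 2.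
Proof.
move=> Kn; rewrite dev_tail//.
have Ev : E (fun x => tail x n.+1 ^+ 2) <= rho ^+ n.+1.
  have H := mean_tail_le alpha_gt0 beta_gt0 L_gt0 LN Xqueue Xinv n.+1.
  apply: le_trans H.
  apply: (le_mean _ mX); [exact: bdd_tail2|exact: bdd_tail|] => x.
  by rewrite expr2 ler_piMl ?tail_ge0 ?tail_le1.
apply: (@le_trans _ _ ((C * r ^+ n.+1) ^+ 2 * rho ^+ n.+1)).
  rewrite ler_pM ?sqr_ge0 ?mean_ge0//; first by move=> x; exact: sqr_ge0.
  by rewrite lerXn2r ?nnegrE ?W_ge0 ?mulr_ge0 ?exprn_ge0 ?(ltW r_gt0) ?(ltW C_gt0).
rewrite exprMn -mulrA exprAC -exprMn ler_piMr ?sqr_ge0//.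
by rewrite exprn_ile1// mulr_ge0 ?sqr_ge0// ltW.
Qed.

Hypothesis noise_case : L = 1%N /\ s ^+ 2 = rho \/ (1 < L)%N.

(** [D1] adds up the constants of both cases: the first summand serves L = 1, the other two serve L
    >= 2, for level 0 and for the part of the noise due to u. In [D2], kappa^4 is the square of a
    shift of the weights by two levels, and 2 comes from v^2 <= 2 c^2 + 2 (v - c)^2. *)
Let D1 := C ^+ 2 * r ^+ 2 * (1 - r * s)^-1 + C ^+ 2 * r ^+ 2
  + 2 * ((C * r ^+ 2 * Cu) ^+ 2 * (1 - r * s)^-1).
Let D2 := 2 * kappa ^+ 4.

Let rs01 : 0 <= r * s < 1. Proof. by rewrite rs_lt1 mulr_ge0// ltW. Qed.

Let W2_le k : W k ^+ 2 <= C ^+ 2 * (r ^+ 2) ^+ k.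
Proof.
rewrite exprAC -exprMn lerXn2r ?nnegrE ?W_ge0 ?mulr_ge0 ?exprn_ge0//.
  exact: ltW.
exact: ltW.
Qed.

Let kappa_ge0 : 0 <= kappa.
Proof.
have W1 : 0 < W 1.
  by have := W_ge 0; rewrite expr0 => H; rewrite -(pmulr_rgt0 _ C_gt0) (lt_le_trans _ H).
by rewrite -(pmulr_lge0 _ W1) (le_trans (W_ge0 2)).
Qed.

(* For L >= 2 and theta = alpha / beta the bound E v k <= rho^k is not enough, and
   E v k.+1 <= E (v k)^2 is used to absorb the noise into E Phi^2. *)
Let noise_le n :
  \sum_(k < n) W k.+1 ^+ 2 * E (fun x => tail x k) <= D1 + D2 * \sum_(k < n) dev k.
Proof.
have S0 : 0 <= \sum_(k < n) dev k by apply: sumr_ge0.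
have D20 : 0 <= D2 by rewrite mulr_ge0// exprn_even_ge0.
have inv0 : 0 <= (1 - r * s)^-1 by rewrite invr_ge0 subr_ge0 ltW.
have T2 : 0 <= C ^+ 2 * r ^+ 2 by apply: mulr_ge0; exact: sqr_ge0.
have T1 : 0 <= C ^+ 2 * r ^+ 2 * (1 - r * s)^-1 by exact: mulr_ge0.
have T3 : 0 <= (C * r ^+ 2 * Cu) ^+ 2 * (1 - r * s)^-1.
  by apply: mulr_ge0 => //; exact: sqr_ge0.
have Ev k : E (fun x => tail x k) <= rho ^+ k by exact: (@mean_tail_le _ _ _ _ _ L).
have Ev0 k : 0 <= E (fun x => tail x k) by apply: mean_ge0 => x; exact: tail_ge0.
have [[_ s2]|L1] := noise_case.
  apply: (@le_trans _ _ (C ^+ 2 * r ^+ 2 * (1 - r * s)^-1)); last first.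
    have DS : 0 <= D2 * \sum_(k < n) dev k by rewrite mulr_ge0.
    by rewrite /D1; lra.
  apply: (sum_le_geometric n rs01 (F := fun k => W k.+1 ^+ 2 * E (fun x => tail x k))) => //.
  move=> k; apply: (@le_trans _ _ (C ^+ 2 * (r ^+ 2) ^+ k.+1 * rho ^+ k)).
    by rewrite ler_pM ?sqr_ge0.
  have -> : C ^+ 2 * (r ^+ 2) ^+ k.+1 * rho ^+ k =
      C ^+ 2 * r ^+ 2 * ((r * s) ^+ k * (r * s) ^+ k).
    by rewrite -s2 !exprS expr0 !exprMn !expr1n; ring.
  have rs0 := (andP rs01).1.
  by rewrite ler_wpM2l// ler_piMl ?exprn_ge0// exprn_ile1// ltW.
case: n S0 => [|n] S0.
  by rewrite !big_ord0 mulr0 addr0; have : 0 <= D1; rewrite /D1; lra.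
rewrite big_ord_recl /=.
have H0 : W 1 ^+ 2 * E (fun x => tail x 0) <= C ^+ 2 * r ^+ 2.
  by rewrite -[leRHS]mulr1 ler_pM ?sqr_ge0.
have step k : W k.+2 ^+ 2 * E (fun x => tail x k.+1) <=
    2 * (W k.+2 ^+ 2 * u k ^+ 2) + 2 * (W k.+2 ^+ 2 * E (fun x => (tail x k - c k) ^+ 2)).
  have -> : 2 * (W k.+2 ^+ 2 * u k ^+ 2) + 2 * (W k.+2 ^+ 2 * E (fun x => (tail x k - c k) ^+ 2))
     = W k.+2 ^+ 2 * (2 * u k ^+ 2 + 2 * E (fun x => (tail x k - c k) ^+ 2)) by ring.
  rewrite ler_wpM2l ?sqr_ge0//.
  apply: (le_trans (mean_tailS_le_sqr alpha_gt0 beta_gt0 L_gt0 LN Xqueue Xinv (ltW rho_lt1) k L1)).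
  have b2 : bdd (fun x : config N => 2 * (tail x k - c k) ^+ 2).
    by apply: bddM; [exact: bdd_cst|exact: bdd_dev].
  rewrite -(meanZ _ mX)// -[X in _ <= X + _](mean_cst P (X 0)) -(meanD _ mX)//; last exact: bdd_cst.
  apply: (le_mean _ mX) => //; first by apply: bddD => //; exact: bdd_cst.
  move=> x; have := sqr_ge0 (tail x k - c k - c k).
  have : c k ^+ 2 <= u k ^+ 2.
    rewrite lerXn2r ?nnegrE ?target_ge0 ?target_le//.
    by rewrite ltW// u_tilde_gt0.
  rewrite !expr2; lra.
have H1 : \sum_(k < n) W k.+2 ^+ 2 * u k ^+ 2 <= (C * r ^+ 2 * Cu) ^+ 2 * (1 - r * s)^-1.
  apply: (sum_le_geometric n rs01 (F := fun k => W k.+2 ^+ 2 * u k ^+ 2)) => [|k].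
    exact: sqr_ge0.
  have rs0 := (andP rs01).1.
  have u2 : u k ^+ 2 <= (Cu * (s ^+ 2) ^+ k) ^+ 2.
    apply: lerXn2r; rewrite ?nnegrE; last exact: u_le.
      by rewrite ltW// u_tilde_gt0.
    by rewrite mulr_ge0 // exprn_ge0 // sqr_ge0.
  apply: (@le_trans _ _ (C ^+ 2 * (r ^+ 2) ^+ k.+2 * (Cu * (s ^+ 2) ^+ k) ^+ 2)).
    by rewrite ler_pM ?sqr_ge0.
  have -> : C ^+ 2 * (r ^+ 2) ^+ k.+2 * (Cu * (s ^+ 2) ^+ k) ^+ 2 =
      (C * r ^+ 2 * Cu) ^+ 2 * ((r * s) ^+ k * ((r * s) ^+ k * (s ^+ k * s ^+ k))).
    by rewrite !exprS !expr0 !exprMn !expr1n; ring.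
  rewrite ler_wpM2l ?sqr_ge0// ler_piMr ?exprn_ge0//.
  have sk0 : 0 <= s ^+ k by rewrite exprn_ge0// ltW.
  have sk1 : s ^+ k <= 1 by rewrite exprn_ile1// ltW.
  have rsk0 : 0 <= (r * s) ^+ k by exact: exprn_ge0.
  have rsk1 : (r * s) ^+ k <= 1 by rewrite exprn_ile1// ltW.
  by apply: mulr_ile1 => //; [exact: mulr_ge0|exact: mulr_ile1].
(* Level 0 has no deviation, so the sum starts at level 1, where the weight of index k+2 can be
   compared with that of index k. *)
have H2 : \sum_(k < n) W k.+2 ^+ 2 * E (fun x => (tail x k - c k) ^+ 2) <=
    kappa ^+ 4 * \sum_(k < n.+1) dev k.
  have -> : \sum_(k < n) W k.+2 ^+ 2 * E (fun x => (tail x k - c k) ^+ 2) =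
      \sum_(0 <= k < n) W k.+2 ^+ 2 * E (fun x => (tail x k - c k) ^+ 2) by rewrite big_mkord.
  case: n {S0 H1} => [|n].
    by rewrite big_geq// mulr_ge0 ?exprn_even_ge0// sumr_ge0.
  rewrite big_nat_recl//.
  have -> : E (fun x => (tail x 0 - c 0) ^+ 2) = 0.
    rewrite -[RHS](mean_cst P (X 0)); congr (mean P _ _); apply/funext => x.
    by rewrite tail0// /target u_tilde0 subrr expr0n.
  rewrite mulr0 add0r big_mkord.
  have k4 : 0 <= kappa ^+ 4 by rewrite exprn_even_ge0.
  apply: (@le_trans _ _ (kappa ^+ 4 * \sum_(k < n) dev k)); last first.
    by rewrite ler_wpM2l// !big_ord_recr/= -addrA lerDl addr_ge0.
  rewrite mulr_sumr; apply: ler_sum => k _; rewrite /dev mulrA ler_wpM2r//.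
  have -> : kappa ^+ 4 * W k.+1 ^+ 2 = (kappa * (kappa * W k.+1)) ^+ 2 by ring.
  rewrite lerXn2r ?nnegrE ?mulr_ge0//.
  by rewrite (le_trans (Wkappa _))// ler_wpM2l.
rewrite /D2 -mulrA.
have : \sum_(k < n) W k.+2 ^+ 2 * E (fun x => tail x k.+1) <=
  2 * \sum_(k < n) W k.+2 ^+ 2 * u k ^+ 2 +
  2 * \sum_(k < n) W k.+2 ^+ 2 * E (fun x => (tail x k - c k) ^+ 2).
  by rewrite !mulr_sumr -big_split; apply: ler_sum => k _; exact: step.
by rewrite /D1; lra.
Qed.

Let noise n : (K < n)%N ->
  \sum_(k < n) W k.+1 ^+ 2 * E (fun x => tail x k) <= D1 + D2 * \sum_(k < n) dev k.
Proof. by move=> _; exact: noise_le. Qed.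

Let D2_ge0 : 0 <= D2. Proof. by rewrite mulr_ge0// exprn_even_ge0. Qed.

Hypothesis N_ge2 : 2 * (alpha + beta) * (2 * kappa ^+ 4) <= g * N%:R.

Let A := 2 / g * (2 / g * Q ^+ 2 + (alpha + beta) * D1).

Let g_gt0 : 0 < g. Proof. by rewrite divr_gt0// mulr_gt0. Qed.

(** Stationarity cancels the mean of the generator and leaves g E(Phi^2) bounded by O(1/N), the
    noise and the flux at level n. The part of the noise proportional to [dev] is at most g/2
    E(Phi^2) by [N_ge2], and the flux is controlled by [dev n] since the weights increase. *)
Let sum_dev_le_dev n : (K < n)%N ->
  \sum_(k < n) dev k <= A / N%:R + (2 / g) ^+ 2 * beta ^+ 2 * dev n.
Proof.
move=> Kn; have NR : 0 < N%:R :> R by rewrite ltr0n.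
have bW k : bdd (fun x : config N => W k.+1 ^+ 2 * tail x k).
  by apply: bddM; [exact: bdd_cst|exact: bdd_tail].
have bS : bdd (fun x : config N => \sum_(k < n) W k.+1 ^+ 2 * tail x k).
  exact: (bdd_sum n (F := fun k x => W k.+1 ^+ 2 * tail x k)).
pose F (v : nat -> R) := (\sum_(k < n) W k.+1 * phi k.+1 (v k.+1)) ^+ 2.
have H0 := mean_generator (ltW alpha_gt0) (ltW beta_gt0) L_gt0 LN' Xqueue Xinv
  (F := F) (bdd_Phi2 n).
have bG : bdd (generator alpha beta L (fun x : config N => F (tail x))).
  by apply: bdd_generator; [exact: ltW|exact: ltW|exact: L_gt0|exact: LN'|exact: bdd_Phi2].
have b1 : bdd (fun x => - g * Phi n x ^+ 2) by apply: bddM => //; exact: bdd_cst.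
have b2 := bdd_cst N (2 / g * (Q ^+ 2 / N%:R)).
have b3' : bdd (fun x : config N => beta ^+ 2 * W n ^+ 2 * tail x n.+1 ^+ 2).
  by apply: bddM => //; exact: bdd_cst.
have b3 : bdd (fun x : config N => 2 / g * (beta ^+ 2 * W n ^+ 2 * tail x n.+1 ^+ 2)).
  by apply: bddM => //; exact: bdd_cst.
have b4 : bdd (fun x : config N => (alpha + beta) / N%:R *
    \sum_(k < n) W k.+1 ^+ 2 * tail x k).
  by apply: bddM => //; exact: bdd_cst.
have b12 := bddD b1 b2; have b123 := bddD b12 b3.
have := le_mean P mX bG (bddD b123 b4) (fun x => generator_Phi2 x Kn).
rewrite H0 (meanD _ mX b123 b4) (meanD _ mX b12 b3) (meanD _ mX b1 b2) mean_cst.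
rewrite (meanZ _ mX _ bS) (meanZ _ mX _ b3') (meanZ _ mX _ (bdd_Phi2 n)).
rewrite (meanZ _ mX _ (bdd_tail2 n.+1)) (mean_sum _ mX n bW).
under eq_bigr do rewrite (meanZ _ mX _ (bdd_tail _ _)).
have Sn := noise Kn; have Fn := sum_dev_le n.
have dn : W n ^+ 2 * E (fun x => tail x n.+1 ^+ 2) <= dev n.
  rewrite (dev_tail (ltnW Kn)) ler_wpM2r ?mean_ge0//.
    by move=> x; exact: sqr_ge0.
  by rewrite lerXn2r ?nnegrE ?W_ge0.
have S0 : 0 <= \sum_(k < n) dev k by apply: sumr_ge0.
move: S0 Sn Fn dn; rewrite -[beta ^+ 2 * _ * _]mulrA.
move: (\sum_(k < n) _ * _) (\sum_(k < n) dev k) (E (fun x => Phi n x ^+ 2))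
  (W n ^+ 2 * E _) (dev n) => T S F2 w dvn S0 Sn Fn dn H.
have I1 := ler_wpM2l (mulr_ge0 (sqr_ge0 (2 / g)) (sqr_ge0 beta)) dn.
have I2 : (alpha + beta) / N%:R * T <= (alpha + beta) / N%:R * D1 + g / 2 * F2.
  have abN : 0 <= (alpha + beta) / N%:R by rewrite divr_ge0 ?addr_ge0 ?ltW.
  apply: (le_trans (ler_wpM2l abN Sn)); rewrite mulrDr lerD2l mulrA.
  have c0 : 0 <= (alpha + beta) / N%:R * D2 by rewrite mulr_ge0.
  apply: (le_trans (ler_wpM2l c0 Fn)); rewrite ler_wpM2r ?(le_trans S0)//.
  rewrite mulrAC ler_pdivrMr//.
  by rewrite [leRHS]mulrAC ler_pdivlMr// mulrC mulrA.
have E1 : F2 <= A / N%:R + (2 / g) ^+ 2 * beta ^+ 2 * w.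
  have -> : F2 = 2 / g * (g / 2 * F2) by field; rewrite gt_eqF.
  have -> : A / N%:R + (2 / g) ^+ 2 * beta ^+ 2 * w =
    2 / g * (2 / g * (Q ^+ 2 / N%:R) + (alpha + beta) / N%:R * D1 + 2 / g * (beta ^+ 2 * w)).
    by rewrite /A; ring.
  by rewrite ler_pM2l; [lra|exact: divr_gt0].
lra.
Qed.

Lemma sum_dev_bound j : \sum_(k < j) dev k <= A / N%:R.
Proof.
apply: (@partial_sums_le R dev _ ((2 / g) ^+ 2 * beta ^+ 2) (C ^+ 2) K) => //.
- by rewrite mulr_ge0 ?sqr_ge0.
- by move=> n /ltnW; exact: dev_le.
Qed.

Definition moment_const :=
  C ^+ 2 * (2 * A + 2 * (C * Cu * a) ^+ 2 * (1 - r * s)^-1).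

(** Splits v - u into v - c, controlled by [dev], and c - u, which vanishes up to level K. Beyond K
    one factor s^k of the bound on u is at most a/m by [K_high], and the rest is summable against
    the weights, so the squares add up to O(1/N). *)
Lemma second_moment_bound j :
  \sum_(k < j) r ^+ 2 ^+ k * E (fun x => (tail x k.+1 - u k.+1) ^+ 2) <=
  moment_const / N%:R.
Proof.
rewrite /moment_const.
have NR : 0 < N%:R :> R by rewrite ltr0n.
have bu k : bdd (fun x : config N => (tail x k - u k) ^+ 2).
  have b : bdd (fun x : config N => tail x k - u k).
    by apply: bddD; [exact: bdd_tail|exact: bdd_cst].
  exact: bddM.
pose e k := W k.+1 ^+ 2 * (c k.+1 - u k.+1) ^+ 2.
have e_le : \sum_(k < j) e k <= (C * Cu * a) ^+ 2 * (1 - r * s)^-1 / N%:R.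
  rewrite mulrAC; apply: (sum_le_geometric j (q := r * s) (F := e)).
  - by rewrite rs_lt1 mulr_ge0 ?ltW.
  - by rewrite divr_ge0// sqr_ge0.
  move=> k; rewrite /e /target; case: (leqP k.+1 K) => kK.
    rewrite subrr expr0n mulr0 mulr_ge0 ?divr_ge0 ?sqr_ge0// exprn_ge0// mulr_ge0 ?ltW//.
  have rs0 : 0 <= r * s by rewrite mulr_ge0 ?ltW.
  have rs_le1 : r * s <= 1 := ltW rs_lt1.
  have CCu : 0 <= C * Cu by rewrite mulr_ge0// ltW.
  have sk : s ^+ k.+1 <= a / m.
    by apply: le_trans K_high; rewrite ler_wiXn2l// ltW.
  have Wu : W k.+1 * u k.+1 <= C * Cu * (r * s) ^+ k.+1 * (a / m).
    apply: (@le_trans _ _ (C * r ^+ k.+1 * (Cu * (s ^+ 2) ^+ k.+1))).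
      by rewrite ler_pM// (ltW (u_tilde_gt0 _ _ _)).
    have -> : C * r ^+ k.+1 * (Cu * (s ^+ 2) ^+ k.+1) =
        C * Cu * (r * s) ^+ k.+1 * s ^+ k.+1 by rewrite expr2 !exprMn; ring.
    by rewrite ler_wpM2l// mulr_ge0// exprn_ge0.
  rewrite sub0r sqrrN -exprMn.
  apply: (@le_trans _ _ ((C * Cu * (r * s) ^+ k.+1 * (a / m)) ^+ 2)).
    have u0 := u_tilde_gt0 L k.+1 rho_gt0.
    by rewrite lerXn2r// nnegrE ?mulr_ge0 ?(ltW u0) ?exprn_ge0 ?invr_ge0 ?(ltW m_gt0)
      ?(ltW a_gt0) ?(ltW C_gt0).
  have -> : (C * Cu * (r * s) ^+ k.+1 * (a / m)) ^+ 2 =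
      (C * Cu * a) ^+ 2 / m ^+ 2 * ((r * s) ^+ k.+1 * (r * s) ^+ k.+1).
    by field; rewrite gt_eqF.
  rewrite m2 ler_wpM2l ?divr_ge0 ?sqr_ge0//.
  apply: (@le_trans _ _ ((r * s) ^+ k * 1)); last by rewrite mulr1.
  rewrite ler_pM ?exprn_ge0 ?exprn_ile1//.
  by rewrite exprS ler_piMl ?exprn_ge0.
apply: (@le_trans _ _ (C ^+ 2 * \sum_(k < j) (2 * dev k + 2 * e k))).
  rewrite mulr_sumr; apply: ler_sum => k _.
  have rW : r ^+ 2 ^+ k <= C ^+ 2 * W k.+1 ^+ 2.
    by rewrite exprAC -exprMn lerXn2r ?nnegrE ?exprn_ge0 ?mulr_ge0 ?W_ge0 ?(ltW r_gt0) ?(ltW C_gt0).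
  have m0 : 0 <= E (fun x => (tail x k.+1 - u k.+1) ^+ 2).
    by apply: mean_ge0 => x; exact: sqr_ge0.
  apply: (le_trans (ler_wpM2r m0 rW)); rewrite -mulrA ler_wpM2l ?sqr_ge0//.
  have -> : 2 * dev k + 2 * e k = W k.+1 ^+ 2 *
     (2 * E (fun x => (tail x k.+1 - c k.+1) ^+ 2) + 2 * (c k.+1 - u k.+1) ^+ 2).
    by rewrite /dev /e; ring.
  rewrite ler_wpM2l ?sqr_ge0//.
  have b2 : bdd (fun x : config N => 2 * (tail x k.+1 - c k.+1) ^+ 2).
    by apply: bddM; [exact: bdd_cst|exact: bdd_dev].
  rewrite -(meanZ _ mX)// -[X in _ <= _ + X](mean_cst P (X 0)) -(meanD _ mX)//; last exact: bdd_cst.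
  apply: (le_mean _ mX) => //; first by apply: bddD => //; exact: bdd_cst.
  move=> x; have := sqr_ge0 (tail x k.+1 - c k.+1 - (c k.+1 - u k.+1)).
  rewrite !expr2; lra.
rewrite -[leRHS]mulrA ler_wpM2l ?sqr_ge0// big_split/= -!mulr_sumr.
have dev_le_A := sum_dev_bound j.
have -> : (2 * A + 2 * (C * Cu * a) ^+ 2 * (1 - r * s)^-1) / N%:R =
  2 * (A / N%:R) + 2 * ((C * Cu * a) ^+ 2 * (1 - r * s)^-1 / N%:R) by ring.
by rewrite lerD// ler_pM2l.
Qed.

End SecondMoment.

(** * Choice of the parameters and conclusion *)

Lemma exists_cutoff (R : realType) (s b : R) : 0 < s < 1 -> 0 < b < s ->
  exists K : nat, [/\ (0 < K)%N, b <= s ^+ K & s ^+ K.+1 <= b].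
Proof.
move=> /andP[s0 s1] /andP[b0 bs].
have /cvgr0Pnorm_lt/(_ _ b0)[n _ H] : (fun n => s ^+ n) @ \oo --> (0 : R).
  by apply: cvg_expr; rewrite gtr0_norm.
have ex : exists k, s ^+ k.+1 <= b.
  exists n; apply/ltW; apply: le_lt_trans (H n.+1 (leqnSn n)); exact: ler_norm.
(* The least exponent is taken: minimality gives the lower bound on s^K, and b < s excludes K =
   0. *)
case: (ex_minnP ex) => [[|K]] HK min.
  by move: HK; rewrite expr1 leNgt bs.
exists K.+1; split => //; rewrite leNgt; apply/negP => lt.
by have := min K (ltW lt); rewrite ltnn.
Qed.

(** [B] is chosen before N, the probability space and the process. Only the cutoff K depends on N,
    and [moment_const] does not involve it. *)
Lemma uniform_second_moment (R : realType) (alpha beta theta : R) (L : nat) :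
  0 < alpha -> 0 < beta -> alpha / beta < 1 -> (1 <= L)%N -> theta < 1 ->
  ((2 <= L)%N -> alpha / beta <= theta) -> (L = 1%N -> alpha / beta < theta) ->
  exists B : R, \forall N \near \oo,
  forall (d : measure_display) (Omega : measurableType d)
    (P : probability Omega R) (X : R -> Omega -> config N),
  queue_length_process alpha beta L P X -> starts_from_invariant_law P X ->
  forall j, \sum_(k < j) (theta^-1) ^+ k *
    mean P (X 0) (fun x => (tail x k.+1 - u_tilde (alpha / beta) L k.+1) ^+ 2)
    <= B / N%:R.
Proof.
move=> alpha0 beta0; set rho := alpha / beta => rho1 L0 theta1 thetaL theta_1.
have rho0 : 0 < rho by exact: divr_gt0.
have rho01 : 0 < rho < 1 by rewrite rho0.
have rho_theta : rho <= theta.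
  case: (leqP 2 L) => [/thetaL//|]; rewrite ltnS => L1.
  by apply/ltW/theta_1/eqP; rewrite eqn_leq L1.
have theta0 : 0 < theta by exact: lt_le_trans rho_theta.
pose r := Num.sqrt theta^-1.
have r2 : r ^+ 2 = theta^-1 by rewrite sqr_sqrtr// invr_ge0 ltW.
have r0 : 0 < r by rewrite sqrtr_gt0 invr_gt0.
have r1 : 1 < r.
  by rewrite -sqrtr1 ltr_sqrt ?invr_gt0// invf_gt1.
have r2rho : r ^+ 2 * rho <= 1 by rewrite r2 mulrC ler_pdivrMr// mul1r.
have lt1_sqr (x : R) : 0 <= x -> x ^+ 2 < 1 -> x < 1.
  by move=> x0; rewrite -[X in _ < X -> _](expr1n R 2) ltr_pXn2r ?nnegrE.
have rhor : rho * r < 1.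
  apply: lt1_sqr; first by rewrite mulr_ge0 ?ltW.
  have -> : (rho * r) ^+ 2 = rho * (r ^+ 2 * rho) by ring.
  by apply: le_lt_trans rho1; rewrite ler_piMr// ltW.
have [W [kappa [gamma [C [gamma0 C0 W0 WS [Wkappa W_ge W_le W_drift]]]]]] :=
  exists_weights rho01 L0 r1 rhor.
(* Both r s < 1, for the smoothing error, and r^2 rho <= 1, for the noise, are
   needed; when L >= 2 and theta = rho this excludes s^2 = rho. *)
have [s [Cu [s0 s1 rs1 Cu0 [u_le s_case]]]] : exists s Cu : R,
  [/\ 0 < s, s < 1, r * s < 1, 0 <= Cu &
   (forall k, u_tilde rho L k <= Cu * (s ^+ 2) ^+ k) /\
   (L = 1%N /\ s ^+ 2 = rho \/ (1 < L)%N)].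
  case: (leqP 2 L) => L2.
    (* For L >= 2 the doubly exponential decay of u allows s = rho, and r s = r rho < 1 holds even
       at theta = rho. *)
    exists rho, rho^-1; split => //.
    - by rewrite mulrC.
    - by rewrite invr_ge0 ltW.
    split; last by right.
    by move=> k; apply: u_tilde_le_sqr => //; rewrite rho0 ltW.
  have L1 : L = 1%N by apply/eqP; rewrite eqn_leq L0 -ltnS L2.
  have s2 : Num.sqrt rho ^+ 2 = rho by rewrite sqr_sqrtr// ltW.
  (* For L = 1, u(k) = rho^k forces s^2 >= rho; with s^2 = rho, r s < 1 is exactly rho < theta. *)
  exists (Num.sqrt rho), 1; split => //.
  - by rewrite sqrtr_gt0.
  - by rewrite -sqrtr1 ltr_sqrt.
  - apply: lt1_sqr; first by rewrite mulr_ge0 ?sqrtr_ge0.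
    by rewrite exprMn s2 r2 mulrC ltr_pdivrMr// mul1r theta_1.
  split; last by left.
  by move=> k; rewrite mul1r s2; apply: u_tilde_le => //; rewrite !ltW.
(* The absolute value avoids a discussion of the sign of [kappa], and the added 1 makes [a]
   positive. *)
pose a := `|2 * (alpha + beta) * kappa| / (beta * gamma) + 1.
have bg0 : 0 < beta * gamma by rewrite mulr_gt0.
have a0 : 0 < a by rewrite ltr_wpDl// divr_ge0// ltW.
have a_ge : 2 * (alpha + beta) * kappa <= beta * gamma * a.
  rewrite /a [leRHS]mulrDr mulr1 [X in _ <= X + _]mulrC divfK ?gt_eqF//.
  by rewrite (le_trans (ler_norm _))// lerDl ltW.
exists (moment_const alpha beta r s kappa gamma C Cu a L); near=> N.
move=> d Omega P X Xq Xi j.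
have LN : (L.*2 <= N)%N by near: N; exact: nbhs_infty_ge.
have N0 : (0 < N)%N by rewrite (leq_trans _ LN)// double_gt0.
have m0 : 0 < Num.sqrt (N%:R : R) by rewrite sqrtr_gt0 ltr0n.
have [K [K0 K_low K_high]] : exists K : nat, [/\ (0 < K)%N,
    a / Num.sqrt (N%:R : R) <= s ^+ K & s ^+ K.+1 <= a / Num.sqrt (N%:R : R)].
  apply: exists_cutoff; first exact/andP.
  rewrite divr_gt0//= ltr_pdivrMr// mulrC -ltr_pdivrMr//.
  have as0 : 0 <= a / s by rewrite divr_ge0// ltW.
  rewrite -[ltLHS]ger0_norm// -sqrtr_sqr ltr_sqrt ?ltr0n//.
  by near: N; exact: nbhs_infty_gtr.
have H1 : 8 * alpha * kappa * (L * L.*2)%:R <= beta * gamma * N%:R.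
  rewrite -ler_pdivrMl//; near: N; exact: nbhs_infty_ger.
have H2 : 2 * (alpha + beta) * (2 * kappa ^+ 4) <= beta * gamma / 2 * N%:R.
  rewrite -ler_pdivrMl ?divr_gt0//; near: N; exact: nbhs_infty_ger.
rewrite -r2; exact: (second_moment_bound alpha0 beta0 L0 LN Xq Xi rho1 gamma0 C0
  W0 WS Wkappa W_ge W_le W_drift r0 s0 s1 rs1 r2rho Cu0 u_le a0 a_ge H1 K0 K_low
  K_high s_case H2 j).
Unshelve. all: by end_near. Qed.

(** Integral and nonnegative series commute, so bounds on all partial sums suffice. The factor N of
    the rescaling cancels 1/N, and the series starting at k = 1 leaves one extra factor 1/theta. *)
Lemma integral_sqnorm_le (R : realType) (theta B : R) (u : nat -> R) (N : nat)
    (d : measure_display) (Omega : measurableType d) (P : probability Omega R)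
    (Y : Omega -> config N) : (0 < N)%N -> 0 < theta ->
  (forall x, measurable [set w | Y w = x]) ->
  (forall j, \sum_(k < j) (theta^-1) ^+ k *
     mean P Y (fun x => (tail x k.+1 - u k.+1) ^+ 2) <= B / N%:R) ->
  (\int[P]_w sqnorm_L2g theta (fun k => (Num.sqrt N%:R * (tail (Y w) k - u k))%R)
   <= (theta^-1 * B)%:E)%E.
Proof.
move=> N0 theta0 mY HB.
have NR : 0 < N%:R :> R by rewrite ltr0n.
have t0 : 0 <= theta^-1 by rewrite invr_ge0 ltW.
pose f k (x : config N) := theta^-1 * N%:R * (theta^-1 ^+ k * (tail x k.+1 - u k.+1) ^+ 2).
have f0 k x : 0 <= f k x.
  apply: mulr_ge0; [exact: mulr_ge0 t0 (ltW NR)|].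
  by apply: mulr_ge0; [exact: exprn_ge0|exact: sqr_ge0].
have bu k : bdd (fun x : config N => (tail x k.+1 - u k.+1) ^+ 2).
  have b : bdd (fun x : config N => tail x k.+1 - u k.+1).
    by apply: bddD; [exact: bdd_tail|exact: bdd_cst].
  exact: bddM.
have bt k : bdd (fun x : config N => theta^-1 ^+ k * (tail x k.+1 - u k.+1) ^+ 2).
  by apply: bddM => //; exact: bdd_cst.
have bf k : bdd (f k) by apply: bddM => //; exact: bdd_cst.
have E w : sqnorm_L2g theta (fun k => (Num.sqrt N%:R * (tail (Y w) k - u k))%R) =
    (\sum_(k <oo) (f k (Y w))%:E)%E.
  rewrite /sqnorm_L2g -nneseries_addn; last first.
    by move=> k; rewrite lee_fin mulr_ge0 ?sqr_ge0// invr_ge0 exprn_ge0// ltW.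
  apply: eq_eseriesr => k _; congr (_%:E).
  rewrite addn1 exprMn sqr_sqrtr// /f exprVn (exprS theta); field.
  by rewrite expf_neq0 ?gt_eqF.
under eq_integral do rewrite E.
rewrite integral_nneseries//; last first.
  by move=> k w _; rewrite lee_fin.
  by move=> k; apply/measurable_EFinP; exact: measurable_comp_config.
apply: lime_le.
  by apply: is_cvg_nneseries => k _ _; apply: integral_ge0 => w _; rewrite lee_fin.
apply: nearW => j; rewrite big_mkord.
under eq_bigr do rewrite -(EFin_mean P mY (bf _)) (meanZ _ mY _ (bt _)) (meanZ _ mY _ (bu _)).
rewrite sumEFin lee_fin -mulr_sumr.
apply: (le_trans (ler_wpM2l _ (HB j))); first by rewrite mulr_ge0.
by rewrite -mulrA ler_wpM2l// mulrC divfK// gt_eqF.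
Qed.

Lemma limn_esup_lt_pinfty (R : realType) (v : (\bar R)^nat) (B : R) :
  (\forall n \near \oo, (v n <= B%:E)%E) -> (limn_esup v < +oo)%E.
Proof.
move=> [n0 _ vB]; apply: (@le_lt_trans _ _ B%:E); last exact: ltry.
rewrite limn_esup_lim; apply: lime_le; first exact: is_cvg_esups.
near=> n; apply: ge_ereal_sup => _ [k /= nk <-]; apply: vB => /=.
by apply: leq_trans nk; near: n; exact: nbhs_infty_ge.
Unshelve. all: by end_near. Qed.

Theorem lemma2p11 (R : realType) (alpha beta theta : R) (L : nat)
  (alpha_gt0 : 0 < alpha) (beta_gt0 : 0 < beta) (rho_lt1 : alpha / beta < 1)
  (L_ge1 : (1 <= L)%N)
  (theta_lt1 : theta < 1)
  (theta_ge : (2 <= L)%N -> alpha / beta <= theta)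
  (theta_gt : L = 1%N -> alpha / beta < theta)
  (d : nat -> measure_display)
  (Omega : forall N : nat, measurableType (d N))
  (P : forall N : nat, probability (Omega N) R)
  (X : forall N : nat, R -> Omega N -> config N)
  (HX : forall N : nat, (L <= N)%N ->
          queue_length_process alpha beta L (P N) (X N))
  (Hinv : forall N : nat, (L <= N)%N ->
          starts_from_invariant_law (P N) (X N)) :
  (limn_esup (fun N : nat =>
     \int[P N]_w sqnorm_L2g theta (Z0 (alpha / beta) L (X N) w)) < +oo)%E.
Proof.
have [B HB] := uniform_second_moment alpha_gt0 beta_gt0 rho_lt1 L_ge1 theta_lt1
  theta_ge theta_gt.
have theta0 : 0 < theta.
  apply: (@lt_le_trans _ _ (alpha / beta)); first exact: divr_gt0.
  case: (leqP 2 L) => [/theta_ge//|]; rewrite ltnS => L1.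
  by apply/ltW/theta_gt/eqP; rewrite eqn_leq L1.
apply: (@limn_esup_lt_pinfty _ _ (theta^-1 * B)); near=> N.
have LN : (L <= N)%N by near: N; exact: nbhs_infty_ge.
apply: (@integral_sqnorm_le R theta B (u_tilde (alpha / beta) L) N _ _ _ (X N 0)) => //.
- exact: leq_trans LN.
- exact: measurable_initial (HX N LN).
- by move=> j; apply: (near HB N) => //; [exact: HX|exact: Hinv].
Unshelve. all: by end_near. Qed.
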